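(* Let $\mathcal{T}$ be a topos and let $\sim$ be a logical relation on $\mathsf{Span}(\mathcal{T})$. Then $\mathsf{Span}_{\sim}(\mathcal{T})$ is a power allegory and $\mathsf{Map}(\mathsf{Span}_{\sim}(\mathcal{T}))$ is a topos.
   Context: Topos means elementary topos; $\mathcal{E}$ and $\mathcal{M}$ are its classes of epimorphisms and monomorphisms. $\mathsf{Span}(\mathcal{T})$ is the category with the objects of $\mathcal{T}$ whose morphisms $A\to B$ are isomorphism classes of spans $(f,g)$, $f:D\to A$, $g:D\to B$, composed by pullback. A compatible relation on $\mathsf{Span}(\mathcal{T})$ is an equivalence relation on spans relating only spans with the same domain and codomain, relating vertically isomorphic spans, and preserved by composition on either side. $\mathsf{Span}_{\sim}(\mathcal{T})$ is the quotient category, with morphisms the classes $[f,g]_{\sim}$. A compatible relation $\sim$ is logical if: (i) $\mathcal{E}\subseteq\,\sim$, i.e. $(e,e)\sim(1,1)$ for every epimorphism $e$ (equivalently $(fe,ge)\sim(f,g)$ for all composable $f,g$ and epi $e$); (ii) for spans $(f,g),(h,k):A\to C$ and a morphism $a:A\to B$, if $(f,g)\sim(h,k)$ then $(\pi_1\forall_{a\times1}m,\pi_2\forall_{a\times1}m)\sim(\pi_1\forall_{a\times1}n,\pi_2\forall_{a\times1}n)$, where $m,n$ are the mono parts of the epi-mono factorizations of $\langle f,g\rangle:D\to A\times C$ and $\langle h,k\rangle:D'\to A\times C$, $a\times1:A\times C\to B\times C$, $\forall_{a\times1}$ is the right adjoint to pullback of subobjects along $a\times 1$ (with $\forall_{a\times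 1}m$ denoting a representing monomorphism), and $\pi_1,\pi_2$ are the projections of $B\times C$. An allegory is a locally ordered 2-category whose hom-posets have binary intersections, with an anti-involution $\phi\mapsto\phi^{\circ}$ satisfying the modular law $\psi\phi\cap\chi\le(\psi\cap\chi\phi^{\circ})\phi$. The structure on $\mathsf{Span}_{\sim}(\mathcal{T})$ is $[f,g]_{\sim}^{\circ}=[g,f]_{\sim}$; $[f,g]_{\sim}\cap[h,k]_{\sim}=[fp,gp]_{\sim}$, where $p$ is the projection to the domain of $f$ of the pullback of $\langle f,g\rangle$ and $\langle h,k\rangle$; and $\alpha\le\beta$ iff $\alpha\cap\beta=\alpha$. A map is a morphism $r$ with $1\le r^{\circ}r$ and $rr^{\circ}\le1$; $\mathsf{Map}(-)$ is the subcategory of maps. A division allegory is an allegory in which, for every $\phi:A\to B$ and object $C$, the order-preserving map $(-)\phi$ from morphisms $B\to C$ to morphisms $A\to C$ has a right adjoint $(-)/\phi$; then $\phi(-)$ also has a right adjoint $\phi\setminus(-)$. Write $(\phi|\psi)=(\phi\setminus\psi)\cap(\psi\setminus\phi)^{\circ}$. A power allegory is a division allegory with an operation assigning to each object $A$ a morphism $\in_A:PA\to A$ such that $(\in_A|\in_A)=1_{PA}$ and $1_B\le(\phi\setminus\in_A)(\in_A\setminus\phi)$ for every $\phi:B\to A$.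
   Formalization: It is additionally assumed that the formulas for the converse and for the intersection of classes are well defined on the ∼-classes; for some logical relations (e.g. on G-sets, G finite abelian, images equal up to translation) the intersection is not. *)

(* Defs.v *)
(* Written against the standard library of Rocq.  Equality of morphisms is
   Leibniz equality; the morphisms of a quotient category are equivalence
   classes, represented as predicates, so extensionality is used below. *)
From Stdlib Require Import FunctionalExtensionality PropExtensionality.
From Stdlib Require Import ProofIrrelevance.

Set Implicit Arguments.
Unset Strict Implicit.
Unset Printing Implicit Defensive.

Declare Scope cat_scope.
Delimit Scope cat_scope with cat.
Open Scope cat_scope.

Record category := Category {
  obj :> Type;
  hom : obj -> obj -> Type;
  idm : forall a, hom a a;
  comp : forall a b c, hom b c -> hom a b -> hom a c;
  compA : forall a b c d (h : hom c d) (g : hom b c) (f : hom a b),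
    comp h (comp g f) = comp (comp h g) f;
  comp1m : forall a b (f : hom a b), comp (idm b) f = f;
  compm1 : forall a b (f : hom a b), comp f (idm a) = f
}.

Arguments hom {c} : rename.
Arguments idm {c} a : rename.
Arguments comp {c a b c0} : rename.

Notation "g ∘ f" := (comp g f) (at level 40, left associativity) : cat_scope.

(** * Limits, factorizations, toposes *)

Definition is_mono (C : category) (a b : C) (m : hom a b) : Prop :=
  forall x (u v : hom x a), m ∘ u = m ∘ v -> u = v.

Definition is_epi (C : category) (a b : C) (e : hom a b) : Prop :=
  forall x (u v : hom b x), u ∘ e = v ∘ e -> u = v.

Definition is_terminal (C : category) (t : C) : Prop :=
  forall x, exists! f : hom x t, True.

Definition is_product (C : category) (a b p : C) (p1 : hom p a) (p2 : hom p b)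
    : Prop :=
  forall x (u : hom x a) (v : hom x b),
    exists! h : hom x p, p1 ∘ h = u /\ p2 ∘ h = v.

Definition is_pullback (C : category) (a b c p : C)
    (f : hom a c) (g : hom b c) (p1 : hom p a) (p2 : hom p b) : Prop :=
  f ∘ p1 = g ∘ p2 /\
  forall x (u : hom x a) (v : hom x b), f ∘ u = g ∘ v ->
    exists! h : hom x p, p1 ∘ h = u /\ p2 ∘ h = v.

Definition has_pullbacks (C : category) : Prop :=
  forall (a b c : C) (f : hom a c) (g : hom b c),
    exists (p : C) (p1 : hom p a) (p2 : hom p b), is_pullback f g p1 p2.

(* [e], with evaluation [ev] defined on a product [ea] of [e] and [a], is an
   exponential [b^a]; the quantified [k] is the morphism [h * 1_a]. *)
Definition is_exponential (C : category) (a b e ea : C)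
    (p1 : hom ea e) (p2 : hom ea a) (ev : hom ea b) : Prop :=
  is_product p1 p2 /\
  forall (c ca : C) (q1 : hom ca c) (q2 : hom ca a), is_product q1 q2 ->
  forall f : hom ca b, exists! h : hom c e,
    forall k : hom ca ea, p1 ∘ k = h ∘ q1 -> p2 ∘ k = q2 -> ev ∘ k = f.

Definition is_subobject_classifier (C : category) (one omega : C)
    (true_ : hom one omega) : Prop :=
  is_terminal one /\
  forall (a b : C) (m : hom a b), is_mono m ->
    exists! chi : hom b omega,
      exists t : hom a one, is_pullback chi true_ m t.

(* Finite limits are given as a terminal object and pullbacks. *)
Record is_topos (C : category) : Prop := IsTopos {
  topos_terminal : exists t : C, is_terminal t;
  topos_pullbacks : has_pullbacks C;
  topos_exponentials : forall a b : C,
    exists (e ea : C) (p1 : hom ea e) (p2 : hom ea a) (ev : hom ea b),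
      is_exponential p1 p2 ev;
  topos_classifier : exists (one omega : C) (true_ : hom one omega),
      is_subobject_classifier true_
}.

(* [m] is the mono part of an epi-mono factorization of [f]. *)
Definition is_mono_part (C : category) (a b d : C) (f : hom d b) (m : hom a b)
    : Prop :=
  is_mono m /\ exists e : hom d a, is_epi e /\ f = m ∘ e.

Definition sub_le (C : category) (a b c : C) (k : hom a c) (n : hom b c)
    : Prop :=
  exists h, k = n ∘ h.

(* [n] represents the value at the subobject [m] of the right adjoint of
   pulling back subobjects along [f]. *)
Definition is_forall_along (C : category) (a b x y : C)
    (f : hom a b) (m : hom x a) (n : hom y b) : Prop :=
  is_mono n /\
  forall (z w : C) (k : hom z b) (k' : hom w a) (f' : hom w z),
    is_mono k -> is_pullback f k k' f' ->
    (sub_le k n <-> sub_le k' m).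

(** * Spans and compatible relations *)

Record span (C : category) (A B : C) := Span {
  apex : C;
  sleft : hom apex A;
  sright : hom apex B
}.
Arguments Span {C A B apex}.

Definition span_id (C : category) (A : C) : span A A := Span (idm A) (idm A).

Definition span_rev (C : category) (A B : C) (s : span A B) : span B A :=
  Span (sright s) (sleft s).

Definition span_iso (C : category) (A B : C) (s t : span A B) : Prop :=
  exists (i : hom (apex s) (apex t)) (j : hom (apex t) (apex s)),
    j ∘ i = idm _ /\ i ∘ j = idm _ /\
    sleft t ∘ i = sleft s /\ sright t ∘ i = sright s.

(* [w] is a composite of [s] followed by [t]. *)
Definition is_span_comp (C : category) (A B D : C)
    (t : span B D) (s : span A B) (w : span A D) : Prop :=
  exists (p : C) (p1 : hom p (apex s)) (p2 : hom p (apex t)),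
    is_pullback (sright s) (sleft t) p1 p2 /\
    w = Span (sleft s ∘ p1) (sright t ∘ p2).

(* [w] is [(f p, g p)] where [s = (f, g)] and [p] is the projection to the
   apex of [s] of the pullback of the pairings of the legs of [s] and [t]. *)
Definition is_span_cap (C : category) (A B : C) (s t w : span A B) : Prop :=
  exists (AB : C) (pi1 : hom AB A) (pi2 : hom AB B)
    (u : hom (apex s) AB) (v : hom (apex t) AB)
    (z : C) (p : hom z (apex s)) (q : hom z (apex t)),
    is_product pi1 pi2 /\
    (pi1 ∘ u = sleft s /\ pi2 ∘ u = sright s) /\
    (pi1 ∘ v = sleft t /\ pi2 ∘ v = sright t) /\
    is_pullback u v p q /\
    w = Span (sleft s ∘ p) (sright s ∘ p).

Definition span_relation (C : category) : Type :=
  forall A B : C, span A B -> span A B -> Prop.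

Record is_compatible (C : category) (R : span_relation C) : Prop :=
  IsCompatible {
    compat_refl : forall A B (s : span A B), R A B s s;
    compat_sym : forall A B (s t : span A B), R A B s t -> R A B t s;
    compat_trans : forall A B (s t u : span A B),
      R A B s t -> R A B t u -> R A B s u;
    compat_iso : forall A B (s t : span A B), span_iso s t -> R A B s t;
    compat_compr : forall A B D (t : span B D) (s s' : span A B) w w',
      R A B s s' -> is_span_comp t s w -> is_span_comp t s' w' ->
      R A D w w';
    compat_compl : forall A B D (t t' : span B D) (s : span A B) w w',
      R B D t t' -> is_span_comp t s w -> is_span_comp t' s w' ->
      R A D w w'
  }.

Record is_logical (T : category) (R : span_relation T) : Prop := IsLogical {
  logical_compatible : is_compatible R;
  logical_epi : forall (D A : T) (e : hom D A), is_epi e ->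
    R A A (Span e e) (span_id A);
  logical_forall : forall (A B D : T) (s t : span A D) (a : hom A B),
    R A D s t ->
    forall (AD : T) (p1 : hom AD A) (p2 : hom AD D)
      (BD : T) (pi1 : hom BD B) (pi2 : hom BD D),
    is_product p1 p2 -> is_product pi1 pi2 ->
    forall (s12 : hom (apex s) AD) (t12 : hom (apex t) AD) (a1 : hom AD BD),
    p1 ∘ s12 = sleft s -> p2 ∘ s12 = sright s ->
    p1 ∘ t12 = sleft t -> p2 ∘ t12 = sright t ->
    pi1 ∘ a1 = a ∘ p1 -> pi2 ∘ a1 = p2 ->
    forall (X Y : T) (m : hom X AD) (n : hom Y AD),
    is_mono_part s12 m -> is_mono_part t12 n ->
    forall (X' Y' : T) (m' : hom X' BD) (n' : hom Y' BD),
    is_forall_along a1 m m' -> is_forall_along a1 n n' ->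
    R B D (Span (pi1 ∘ m') (pi2 ∘ m')) (Span (pi1 ∘ n') (pi2 ∘ n'))
}.

(** * The quotient category *)

Record span_class (C : category) (R : span_relation C) (A B : C) := SpanClass {
  in_class : span A B -> Prop;
  in_classP : exists s, forall t, in_class t <-> R A B s t
}.

Lemma span_class_eq (C : category) (R : span_relation C) (A B : C)
    (x y : span_class R A B) :
  (forall s, in_class x s <-> in_class y s) -> x = y.
Proof.
destruct x as [x xP], y as [y yP]; simpl; intros xy.
assert (E : x = y).
  apply functional_extensionality; intros s.
  now apply propositional_extensionality.
subst y; f_equal; apply proof_irrelevance.
Qed.

Definition cls (C : category) (R : span_relation C) (A B : C) (s : span A B)
    : span_class R A B :=
  @SpanClass C R A B (R A B s)
    (ex_intro _ s (fun t => conj (fun h => h) (fun h => h))).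
Arguments cls {C} R {A B} s.

Lemma cls_surj (C : category) (R : span_relation C) (A B : C)
    (x : span_class R A B) : exists s, x = cls R s.
Proof. destruct (in_classP x) as [s sP]; exists s; now apply span_class_eq. Qed.

Lemma cls_eq (C : category) (R : span_relation C) (hR : is_compatible R)
    (A B : C) (s t : span A B) : cls R s = cls R t <-> R A B s t.
Proof.
split.
  intros E; change (in_class (cls R s) t); rewrite E; apply (compat_refl hR).
intros st; apply span_class_eq; intros u; simpl; split; intros h.
  exact (compat_trans hR (compat_sym hR st) h).
exact (compat_trans hR st h).
Qed.

Section QuotientCategory.

Variables (C : category) (hC : has_pullbacks C).
Variables (R : span_relation C) (hR : is_compatible R).
Arguments R : clear implicits.

Lemma span_comp_ex (A B D : C) (t : span B D) (s : span A B) :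
  exists w, is_span_comp t s w.
Proof.
destruct (hC (sright s) (sleft t)) as (p & p1 & p2 & pP).
exists (Span (sleft s ∘ p1) (sright t ∘ p2)), p, p1, p2; auto.
Qed.

(* The class of the composites of representatives; see [comp_clsE]. *)
Definition comp_cls_pred (A B D : C) (y : span_class R B D)
    (x : span_class R A B) (u : span A D) : Prop :=
  exists s t w, in_class x s /\ in_class y t /\ is_span_comp t s w /\ R A D w u.

Lemma comp_cls_predE (A B D : C) (t : span B D) (s : span A B) (w : span A D) :
  is_span_comp t s w ->
  forall u, comp_cls_pred (cls R t) (cls R s) u <-> R A D w u.
Proof.
intros wP u; split.
  intros (s' & t' & w' & ss' & tt' & w'P & w'u); simpl in ss', tt'.
  destruct (span_comp_ex t s') as [v vP].
  apply (compat_trans hR (compat_compr hR ss' wP vP)).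
  exact (compat_trans hR (compat_compl hR tt' vP w'P) w'u).
intros wu; exists s, t, w; repeat split; auto; apply (compat_refl hR).
Qed.

Lemma comp_cls_predP (A B D : C) (y : span_class R B D)
    (x : span_class R A B) :
  exists w, forall u, comp_cls_pred y x u <-> R A D w u.
Proof.
destruct (cls_surj x) as [s ->], (cls_surj y) as [t ->].
destruct (span_comp_ex t s) as [w wP]; exists w.
exact (comp_cls_predE wP).
Qed.

Definition comp_cls (A B D : C) (y : span_class R B D)
    (x : span_class R A B) : span_class R A D :=
  SpanClass (comp_cls_predP y x).

Lemma comp_clsE (A B D : C) (t : span B D) (s : span A B) (w : span A D) :
  is_span_comp t s w -> comp_cls (cls R t) (cls R s) = cls R w.
Proof. intros wP; apply span_class_eq; exact (comp_cls_predE wP). Qed.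

Lemma pullback_paste (a b c d p q : C) (f : hom a c) (g : hom b c)
    (h : hom d b) (p1 : hom p a) (p2 : hom p b) (q1 : hom q p) (q2 : hom q d) :
  is_pullback f g p1 p2 -> is_pullback p2 h q1 q2 ->
  is_pullback f (g ∘ h) (p1 ∘ q1) q2.
Proof.
intros [E1 U1] [E2 U2]; split.
  now rewrite compA, E1, <- compA, E2, compA.
intros x u v E.
rewrite <- compA in E; destruct (U1 x u (h ∘ v) E) as (k & [k1 k2] & kU).
destruct (U2 x k v k2) as (l & [l1 l2] & lU).
exists l; split.
  split; [now rewrite <- compA, l1 | exact l2].
intros l' [l'1 l'2]; apply lU; split; auto.
symmetry; apply kU; split; [now rewrite compA |].
now rewrite compA, E2, <- compA, l'2.
Qed.

Lemma pullback_sym (a b c p : C) (f : hom a c) (g : hom b c)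
    (p1 : hom p a) (p2 : hom p b) :
  is_pullback f g p1 p2 -> is_pullback g f p2 p1.
Proof.
intros [E U]; split; [now symmetry |].
intros x u v uv; destruct (U x v u (eq_sym uv)) as (h & [h1 h2] & hU).
exists h; split; [now split |].
intros k [k1 k2]; apply hU; now split.
Qed.

Lemma comp_clsA (A B D E : C) (z : span_class R D E) (y : span_class R B D)
    (x : span_class R A B) :
  comp_cls z (comp_cls y x) = comp_cls (comp_cls z y) x.
Proof.
destruct (cls_surj x) as [s ->], (cls_surj y) as [t ->].
destruct (cls_surj z) as [u ->].
destruct (hC (sright s) (sleft t)) as (p & p1 & p2 & pP).
destruct (hC (sright t) (sleft u)) as (q & q1 & q2 & qP).
destruct (hC p2 q1) as (r & r1 & r2 & rP).
rewrite (@comp_clsE _ _ _ t s (Span (sleft s ∘ p1) (sright t ∘ p2)));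
  [| exists p, p1, p2; auto].
rewrite (@comp_clsE _ _ _ u t (Span (sleft t ∘ q1) (sright u ∘ q2)));
  [| exists q, q1, q2; auto].
rewrite (@comp_clsE _ _ _ u _
  (Span (sleft s ∘ (p1 ∘ r1)) (sright u ∘ (q2 ∘ r2)))).
  symmetry; apply comp_clsE; exists r, (p1 ∘ r1), r2; split.
    exact (pullback_paste pP rP).
  simpl; now rewrite !compA.
exists r, r1, (q2 ∘ r2); split; simpl; [| now rewrite !compA].
apply pullback_sym.
exact (pullback_paste (pullback_sym qP) (pullback_sym rP)).
Qed.

Lemma comp_cls1m (A B : C) (x : span_class R A B) :
  comp_cls (cls R (span_id B)) x = x.
Proof.
destruct (cls_surj x) as [[d f g] ->]; apply comp_clsE.
exists d, (idm d), g; simpl; split; [| now rewrite compm1, comp1m].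
split; [now rewrite compm1, comp1m |].
intros y u v; rewrite comp1m; intros E; exists u; split.
  split; [apply comp1m | exact E].
intros k [ku _]; now rewrite <- ku, comp1m.
Qed.

Lemma comp_clsm1 (A B : C) (x : span_class R A B) :
  comp_cls x (cls R (span_id A)) = x.
Proof.
destruct (cls_surj x) as [[d f g] ->]; apply comp_clsE.
exists d, f, (idm d); simpl; split; [| now rewrite compm1, comp1m].
split; [now rewrite compm1, comp1m |].
intros y u v; rewrite comp1m; intros E; exists v; split.
  split; [now symmetry | apply comp1m].
intros k [_ kv]; now rewrite <- kv, comp1m.
Qed.

Definition span_quotient : category :=
  @Category C (fun A B => span_class R A B) (fun A => cls R (span_id A))
    comp_cls comp_clsA comp_cls1m comp_clsm1.

End QuotientCategory.

(** * Allegories *)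

Record allegory_structure (C : category) := AllegoryStructure {
  ale : forall a b : C, hom a b -> hom a b -> Prop;
  acap : forall a b : C, hom a b -> hom a b -> hom a b;
  aconv : forall a b : C, hom a b -> hom b a
}.
Arguments ale {C} a0 {a b} : rename.
Arguments acap {C} a0 {a b} : rename.
Arguments aconv {C} a0 {a b} : rename.

Record is_allegory (C : category) (S : allegory_structure C) : Prop :=
  IsAllegory {
    ale_refl : forall (a b : C) (f : hom a b), ale S f f;
    ale_trans : forall (a b : C) (f g h : hom a b),
      ale S f g -> ale S g h -> ale S f h;
    ale_anti : forall (a b : C) (f g : hom a b),
      ale S f g -> ale S g f -> f = g;
    ale_comp : forall (a b c : C) (g g' : hom b c) (f f' : hom a b),
      ale S g g' -> ale S f f' -> ale S (g ∘ f) (g' ∘ f');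
    ale_cap : forall (a b : C) (f g h : hom a b),
      ale S h (acap S f g) <-> ale S h f /\ ale S h g;
    aconvK : forall (a b : C) (f : hom a b), aconv S (aconv S f) = f;
    aconv1 : forall a : C, aconv S (idm a) = idm a;
    aconvM : forall (a b c : C) (g : hom b c) (f : hom a b),
      aconv S (g ∘ f) = aconv S f ∘ aconv S g;
    aconv_le : forall (a b : C) (f g : hom a b),
      ale S f g -> ale S (aconv S f) (aconv S g);
    modular_law : forall (a b c : C) (g : hom b c) (f : hom a b) (h : hom a c),
      ale S (acap S (g ∘ f) h) (acap S g (h ∘ aconv S f) ∘ f)
  }.

(* [rdiv f g] is the value at [g] of the right adjoint of composition with [f]
   on the right. *)
Record division (C : category) (S : allegory_structure C) := Division {
  rdiv : forall a b c : C, hom a b -> hom a c -> hom b c;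
  rdivP : forall (a b c : C) (f : hom a b) (g : hom a c) (h : hom b c),
    ale S (h ∘ f) g <-> ale S h (rdiv f g)
}.

Record is_division_allegory (C : category) (S : allegory_structure C) : Prop :=
  IsDivisionAllegory {
    division_allegory :> is_allegory S;
    has_division : inhabited (division S)
  }.

(* The right adjoint of composition with [f] on the left; see [ldivP]. *)
Definition ldiv (C : category) (S : allegory_structure C) (D : division S)
    (a b c : C) (f : hom a b) (g : hom c b) : hom c a :=
  aconv S (rdiv D (aconv S f) (aconv S g)).

Lemma ldivP (C : category) (S : allegory_structure C) (D : division S)
    (hS : is_allegory S) (a b c : C) (f : hom a b) (g : hom c b)
    (h : hom c a) :
  ale S (f ∘ h) g <-> ale S h (ldiv D f g).
Proof.
assert (convE : forall (x y : C) (k l : hom x y),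
    ale S k l <-> ale S (aconv S k) (aconv S l)).
  intros x y k l; split; intros kl; [now apply (aconv_le hS) |].
  rewrite <- (aconvK hS k), <- (aconvK hS l); now apply (aconv_le hS).
unfold ldiv; rewrite (convE _ _ (f ∘ h)), (convE _ _ h).
rewrite (aconvM hS), (aconvK hS); apply rdivP.
Qed.

(* Symmetric division [(f | g)]. *)
Definition sdiv (C : category) (S : allegory_structure C) (D : division S)
    (a b c : C) (f : hom a b) (g : hom c b) : hom c a :=
  acap S (ldiv D f g) (aconv S (ldiv D g f)).

(* Adjoints are unique, so the choice of [D] is immaterial. *)
Record is_power_allegory (C : category) (S : allegory_structure C) : Prop :=
  IsPowerAllegory {
    power_division :> is_division_allegory S;
    has_power : exists (D : division S) (P : C -> C)
        (mem : forall a : C, hom (P a) a),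
      (forall a : C, sdiv D (mem a) (mem a) = idm (P a)) /\
      (forall (a b : C) (f : hom b a),
        ale S (idm b) (ldiv D f (mem a) ∘ ldiv D (mem a) f))
  }.

Definition is_map (C : category) (S : allegory_structure C) (a b : C)
    (r : hom a b) : Prop :=
  ale S (idm a) (aconv S r ∘ r) /\ ale S (r ∘ aconv S r) (idm b).

Section MapCategory.

Variables (C : category) (S : allegory_structure C) (hS : is_allegory S).

Record map_hom (a b : C) := MapHom {
  map_val : hom a b;
  map_valP : is_map S map_val
}.

Lemma map_hom_eq (a b : C) (f g : map_hom a b) :
  map_val f = map_val g -> f = g.
Proof.
destruct f as [f fP], g as [g gP]; simpl; intros E; subst g.
f_equal; apply proof_irrelevance.
Qed.

Lemma is_map_id (a : C) : is_map S (idm a).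
Proof.
split; rewrite (aconv1 hS), comp1m; apply (ale_refl hS).
Qed.

Lemma is_map_comp (a b c : C) (g : hom b c) (f : hom a b) :
  is_map S g -> is_map S f -> is_map S (g ∘ f).
Proof.
intros [g1 g2] [f1 f2]; split; rewrite (aconvM hS).
  apply (ale_trans hS f1).
  rewrite <- compA, (compA (aconv S g)).
  apply (ale_comp hS); [apply (ale_refl hS) |].
  rewrite <- (comp1m f) at 1.
  apply (ale_comp hS); [exact g1 | apply (ale_refl hS)].
refine (ale_trans hS _ g2).
rewrite <- compA, (compA f).
apply (ale_comp hS); [apply (ale_refl hS) |].
rewrite <- (comp1m (aconv S g)) at 2.
apply (ale_comp hS); [exact f2 | apply (ale_refl hS)].
Qed.

Definition map_category : category.
Proof.
refine (@Category C map_hom (fun a => MapHom (is_map_id a))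
  (fun a b c g f => MapHom (is_map_comp (map_valP g) (map_valP f))) _ _ _);
  intros; apply map_hom_eq; simpl.
- apply compA.
- apply comp1m.
- apply compm1.
Defined.

End MapCategory.

(** * The allegory structure on the quotient of spans *)

(* The formulas for [°] and [∩] on representatives determine [S] uniquely.
   That they descend to classes is part of the existence of such an [S].  For
   [∩] it is not automatic: on the topos of [G]-sets, [G] a nontrivial finite
   abelian group, let [s] and [t] be related iff their images are equal up to
   the action of an element of [G] on the first component.  This relation is
   logical and relates [1_G] to the graph of every translation of [G], whereas
   the intersection of [1_G] with a nontrivial translation is empty. *)
Record is_span_structure (C : category) (hC : has_pullbacks C)
    (R : span_relation C) (hR : is_compatible R)
    (S : allegory_structure (span_quotient hC hR)) : Prop := IsSpanStructure {
  span_convE : forall (A B : C) (s : span A B),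
    aconv S (a := A) (b := B) (cls R s) = cls R (span_rev s);
  span_capE : forall (A B : C) (s t w : span A B), is_span_cap s t w ->
    acap S (a := A) (b := B) (cls R s) (cls R t) = cls R w;
  span_leE : forall (A B : C) (x y : span_class R A B),
    ale S (a := A) (b := B) x y <-> acap S (a := A) (b := B) x y = x
}.

(* Main.v *)
From Stdlib Require Import IndefiniteDescription.
Require Import Defs.

(* Modulo a logical relation a span equals its image, so the quotient is a
   quotient of the allegory of relations of the topos.  Ordering, composition
   and intersection of classes are computed on representatives, through
   generalized elements.  A span [(f, g)] is the graph of [g] after the converse
   of the graph of [f]; composition with a converse graph has a right adjoint
   because graphs are maps, and composition with the graph of [g] has universal
   quantification along [g * 1] as right adjoint, which condition (ii) makes
   well defined and monotone on classes.  Power objects are those of the topos.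

   The quotient is unital and tabular.  In any such allegory, limits of maps are
   tabulations, the power object of the unit classifies subobjects of maps, and
   the exponential [B^A] is the object of those relations in the power object of
   [A * B] that are graphs of maps. *)

Set Implicit Arguments.
Unset Strict Implicit.
Unset Printing Implicit Defensive.

(** * Generalized elements of spans *)

(** Only the existence of [h] is asked, so multiplicities are forgotten: two spans have the same
    elements iff each factors through the other. *)
Definition el (C : category) (A B : C) (s : span A B) (W : C)
    (x : hom W A) (y : hom W B) : Prop :=
  exists h : hom W (apex s), sleft s ∘ h = x /\ sright s ∘ h = y.

(** The spans that are relations, described without choosing a product. *)
Definition jointly_monic (C : category) (A B : C) (s : span A B) : Prop :=
  forall (W : C) (h k : hom W (apex s)),
    sleft s ∘ h = sleft s ∘ k -> sright s ∘ h = sright s ∘ k -> h = k.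

Definition graph (C : category) (A B : C) (f : hom A B) : span A B :=
  Span (idm A) f.

Section Elements.

Variable C : category.
Implicit Types A B D W : C.

Lemma el_restrict A B (s : span A B) W W' (w : hom W' W) x y :
  el s x y -> el s (x ∘ w) (y ∘ w).
Proof.
intros (h & <- & <-); exists (h ∘ w); now rewrite !compA.
Qed.

Lemma el_legs A B (s : span A B) : el s (sleft s) (sright s).
Proof. exists (idm _); now rewrite !compm1. Qed.

Lemma el_graph A B (f : hom A B) W (x : hom W A) y :
  el (graph f) x y <-> f ∘ x = y.
Proof.
unfold el; simpl; split.
  intros (h & <- & <-); now rewrite comp1m.
intros <-; exists x; now rewrite comp1m.
Qed.

Lemma el_id A W (x y : hom W A) : el (span_id A) x y <-> x = y.
Proof. change (span_id A) with (graph (idm A)); now rewrite el_graph, comp1m. Qed.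

Lemma el_rev A B (s : span A B) W (x : hom W A) (y : hom W B) :
  el (span_rev s) y x <-> el s x y.
Proof. unfold el; simpl; firstorder. Qed.

(** No image is taken: the middle element comes from the pullback, at the same stage [W]. *)
Lemma el_comp A B D (t : span B D) (s : span A B) w : is_span_comp t s w ->
  forall W (x : hom W A) (z : hom W D),
    el w x z <-> exists y, el s x y /\ el t y z.
Proof.
intros (p & p1 & p2 & [E U] & ->) W x z; unfold el; simpl; split.
  intros (h & <- & <-); exists (sright s ∘ p1 ∘ h); split.
    exists (p1 ∘ h); now rewrite !compA.
  exists (p2 ∘ h); now rewrite E, !compA.
intros (y & (h & <- & h2) & (k & k1 & <-)).
destruct (U W h k) as (l & [l1 l2] & _); [congruence |].
exists l; now rewrite <- !compA, l1, l2.
Qed.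

Lemma el_cap A B (s t w : span A B) : is_span_cap s t w ->
  forall W (x : hom W A) (y : hom W B), el w x y <-> el s x y /\ el t x y.
Proof.
intros (AB & pi1 & pi2 & u & v & z & p & q & HP & [u1 u2] & [v1 v2] & [E U] & ->).
intros W x y; unfold el; simpl; split.
  intros (h & <- & <-); split.
    exists (p ∘ h); now rewrite !compA.
  exists (q ∘ h).
  rewrite <- u1, <- u2, <- v1, <- v2.
  now rewrite <- !compA, (compA u), (compA v), E.
intros [(h & h1 & h2) (k & k1 & k2)].
destruct (U W h k) as (l & [l1 l2] & _).
  destruct (HP W x y) as (m & _ & mU).
  transitivity m; [symmetry |]; apply mU; rewrite !compA.
    now rewrite u1, u2.
  now rewrite v1, v2.
exists l; now rewrite <- !compA, l1.
Qed.

(** * Products, pullbacks and subobjects *)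

Lemma product_pair A B P (p1 : hom P A) (p2 : hom P B) : is_product p1 p2 ->
  forall W (u : hom W A) (v : hom W B), exists h, p1 ∘ h = u /\ p2 ∘ h = v.
Proof. intros HP W u v; destruct (HP W u v) as (h & hP & _); now exists h. Qed.

Lemma product_ext A B P (p1 : hom P A) (p2 : hom P B) : is_product p1 p2 ->
  forall W (h k : hom W P), p1 ∘ h = p1 ∘ k -> p2 ∘ h = p2 ∘ k -> h = k.
Proof.
intros HP W h k E1 E2; destruct (HP W (p1 ∘ k) (p2 ∘ k)) as (l & _ & lU).
transitivity l; [symmetry |]; now apply lU.
Qed.

Lemma pullback_ext A B D P (f : hom A D) (g : hom B D) (p1 : hom P A) p2 :
  is_pullback f g p1 p2 ->
  forall W (h k : hom W P), p1 ∘ h = p1 ∘ k -> p2 ∘ h = p2 ∘ k -> h = k.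
Proof.
intros [E U] W h k E1 E2; destruct (U W (p1 ∘ k) (p2 ∘ k)) as (l & _ & lU).
  now rewrite !compA, E.
transitivity l; [symmetry |]; now apply lU.
Qed.

Lemma pullback_mono A B D P (f : hom A D) (m : hom B D) (p1 : hom P A) p2 :
  is_mono m -> is_pullback f m p1 p2 -> is_mono p1.
Proof.
intros hm pP W h k hk; apply (pullback_ext pP hk), hm.
now rewrite !compA, <- (proj1 pP), <- !compA, hk.
Qed.

Lemma pullback_sub_le A B D P (f : hom A D) (m : hom B D) (p1 : hom P A) p2 :
  is_pullback f m p1 p2 ->
  forall W (x : hom W A), sub_le x p1 <-> sub_le (f ∘ x) m.
Proof.
intros [E U] W x; split.
  intros (h & ->); exists (p2 ∘ h); now rewrite !compA, E.
intros (h & hE); destruct (U W x h hE) as (k & [k1 _] & _); now exists k.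
Qed.

Lemma sub_le_restrict A B W W' (x : hom W A) (m : hom B A) (w : hom W' W) :
  sub_le x m -> sub_le (x ∘ w) m.
Proof. intros (h & ->); exists (h ∘ w); now rewrite compA. Qed.

Lemma pairing_mono A B (s : span A B) P (p1 : hom P A) (p2 : hom P B) u :
  p1 ∘ u = sleft s -> p2 ∘ u = sright s -> jointly_monic s -> is_mono u.
Proof.
intros u1 u2 hs W h k hk; apply hs; rewrite <- ?u1, <- ?u2, <- !compA; now rewrite hk.
Qed.

Lemma pairing_sub_le A B (s : span A B) P (p1 : hom P A) (p2 : hom P B) u :
  is_product p1 p2 -> p1 ∘ u = sleft s -> p2 ∘ u = sright s ->
  forall W (x : hom W P), sub_le x u <-> el s (p1 ∘ x) (p2 ∘ x).
Proof.
intros HP u1 u2 W x; unfold el; rewrite <- u1, <- u2; split.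
  intros (h & ->); exists h; now rewrite !compA.
intros (h & h1 & h2); exists h; apply (product_ext HP); now rewrite ?compA.
Qed.

End Elements.

(** * Power objects, universal quantification and images in a topos *)

Section Topos.

Variables (T : category) (hT : is_topos T).

Lemma topos_product (A B : T) :
  exists (P : T) (p1 : hom P A) (p2 : hom P B), is_product p1 p2.
Proof.
destruct (topos_terminal hT) as [t ht].
destruct (ht A) as (f & _), (ht B) as (g & _).
destruct (topos_pullbacks hT f g) as (P & p1 & p2 & _ & U).
exists P, p1, p2; intros W u v; apply U.
destruct (ht W) as (k & _ & kU); transitivity k; [symmetry |]; now apply kU.
Qed.

(** [n] is the pullback of the graph of [f] along the graph of [g]. *)
Lemma topos_equalizer (A B : T) (f g : hom A B) :
  exists (E : T) (n : hom E A), is_mono n /\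
    forall (W : T) (x : hom W A), sub_le x n <-> f ∘ x = g ∘ x.
Proof.
destruct (topos_product A B) as (P & p1 & p2 & HP).
destruct (product_pair HP (idm A) f) as (u & u1 & u2).
destruct (product_pair HP (idm A) g) as (v & v1 & v2).
assert (uM : is_mono u).
  intros W h k hk; rewrite <- (comp1m h), <- (comp1m k), <- u1, <- !compA.
  now rewrite hk.
destruct (topos_pullbacks hT v u) as (E & n & n' & nP).
exists E, n; split; [exact (pullback_mono uM nP) |].
intros W x; rewrite (pullback_sub_le nP); split.
  intros (h & hE).
  assert (xh : x = h).
    now rewrite <- (comp1m x), <- (comp1m h), <- v1 at 1; rewrite <- compA, hE, compA, u1.
  subst h; now rewrite <- v2, <- u2, <- !compA, hE.
intros E'; exists x; apply (product_ext HP); rewrite !compA.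
  now rewrite u1, v1.
now rewrite u2, v2.
Qed.

(** Both morphisms classify the pullback of [tr] along [c]. *)
Lemma omega_ext (one omega : T) (tr : hom one omega) (B : T)
    (c c' : hom B omega) : is_subobject_classifier tr ->
  (forall (W : T) (b : hom W B), sub_le (c ∘ b) tr <-> sub_le (c' ∘ b) tr) ->
  c = c'.
Proof.
intros [h1 hcl] cc'.
assert (one_eq : forall W (u v : hom W one), u = v).
  intros W u v; destruct (h1 W) as (k & _ & kU).
  transitivity k; [symmetry |]; now apply kU.
assert (trM : is_mono tr) by (intros W u v _; apply one_eq).
destruct (topos_pullbacks hT c tr) as (X & m & t & mP).
destruct (hcl X B m (pullback_mono trM mP)) as (d & _ & dU).
transitivity d; [symmetry |]; apply dU; [now exists t |].
assert (mT : sub_le (c' ∘ m) tr) by (apply cc'; exists t; apply mP).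
destruct mT as (t' & Et'); exists t'; split; [exact Et' |].
intros W u v uv.
assert (uT : sub_le (c ∘ u) tr) by (apply cc'; now exists v).
destruct uT as (w & Ew); destruct (proj2 mP W u w Ew) as (h & [hu _] & _).
exists h; split; [split; [exact hu | apply one_eq] |].
intros k [ku _]; apply (pullback_mono trM mP); congruence.
Qed.

(** [PA] is [omega^A] and [E] is the subobject of [PA * A] classified by evaluation. Transposing
    characteristic morphisms gives [c]; [omega_ext] gives its uniqueness. *)
Lemma topos_power (A : T) : exists (PA : T) (E : span PA A),
  jointly_monic E /\
  (forall (Z : T) (r : span Z A), jointly_monic r ->
    exists c : hom Z PA, forall (W : T) (z : hom W Z) (a : hom W A),
      el r z a <-> el E (c ∘ z) a) /\
  (forall (Z : T) (c c' : hom Z PA),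
    (forall (W : T) (z : hom W Z) (a : hom W A),
      el E (c ∘ z) a <-> el E (c' ∘ z) a) -> c = c').
Proof.
destruct (topos_classifier hT) as (one & omega & tr & htr).
destruct (topos_exponentials hT A omega) as (e & ea & p1 & p2 & ev & HP & HE).
destruct (topos_pullbacks hT ev tr) as (X & m & t & mP).
assert (elE : forall W (x : hom W ea),
    el (Span (p1 ∘ m) (p2 ∘ m)) (p1 ∘ x) (p2 ∘ x) <-> sub_le (ev ∘ x) tr).
  intros W x; rewrite <- (pullback_sub_le mP).
  symmetry; now apply (@pairing_sub_le T e A (Span (p1 ∘ m) (p2 ∘ m))).
exists e, (Span (p1 ∘ m) (p2 ∘ m)); split; [| split].
- intros W h k; simpl; rewrite <- !compA; intros E1 E2.
  assert (mM : is_mono m).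
    apply (fun h => pullback_mono h mP); intros V u v _.
    destruct (proj1 htr V) as (l & _ & lU); transitivity l; [symmetry |]; now apply lU.
  apply mM; now apply (product_ext HP).
- intros Z r hr; destruct (topos_product Z A) as (ZA & q1 & q2 & HQ).
  destruct (product_pair HQ (sleft r) (sright r)) as (u & u1 & u2).
  destruct (proj2 htr _ _ u (pairing_mono u1 u2 hr)) as (c & (t' & cP) & _).
  destruct (HE Z ZA q1 q2 HQ c) as (h & hP & _).
  destruct (product_pair HP (h ∘ q1) q2) as (k & k1 & k2).
  specialize (hP k k1 k2); exists h; intros W z a.
  destruct (product_pair HQ z a) as (y & <- & <-).
  rewrite <- (pairing_sub_le HQ u1 u2), (pullback_sub_le cP), <- hP.
  now rewrite <- compA, <- elE, !compA, k1, k2.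
- intros Z c c' cc'; destruct (topos_product Z A) as (ZA & q1 & q2 & HQ).
destruct (product_pair HP (c ∘ q1) q2) as (k & k1 & k2).
destruct (product_pair HP (c' ∘ q1) q2) as (k' & k'1 & k'2).
assert (kk' : ev ∘ k = ev ∘ k').
  apply (omega_ext htr); intros W y.
  rewrite <- !compA, <- !elE, !compA, k1, k2, k'1, k'2, <- !compA; apply cc'.
destruct (HE Z ZA q1 q2 HQ (ev ∘ k)) as (h & _ & hU).
transitivity h; [symmetry |]; apply hU.
  intros l l1 l2; f_equal; apply (product_ext HP); congruence.
intros l l1 l2; rewrite kk'; f_equal; apply (product_ext HP); congruence.
Qed.

(* [n] is the equalizer of the two maps from [B] to the power object of [A] that
   send [y] to its fibre, respectively to the part of its fibre inside [m]. *)
Lemma topos_forall (A B X : T) (f : hom A B) (m : hom X A) : is_mono m ->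
  exists (Y : T) (n : hom Y B), is_mono n /\
    forall (W : T) (y : hom W B), sub_le y n <->
      forall (W' : T) (w : hom W' W) (a : hom W' A),
        f ∘ a = y ∘ w -> sub_le a m.
Proof.
intros hm; destruct (topos_power A) as (PA & E & _ & Eex & Eext).
destruct (Eex B (Span f (idm A))) as (c1 & c1P).
  intros W h k; simpl; now rewrite !comp1m.
destruct (Eex B (Span (f ∘ m) m)) as (c2 & c2P).
  intros W h k _; apply hm.
destruct (topos_equalizer c1 c2) as (Y & n & hn & nP).
exists Y, n; split; [exact hn |]; intros W y; rewrite nP.
assert (c1E : forall W' (w : hom W' W) (a : hom W' A),
    el E (c1 ∘ y ∘ w) a <-> f ∘ a = y ∘ w).
  intros W' w a; rewrite <- compA, <- c1P; unfold el; simpl; split.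
    intros (h & <- & <-); now rewrite comp1m.
  intros fa; exists a; now rewrite comp1m.
assert (c2E : forall W' (w : hom W' W) (a : hom W' A),
    el E (c2 ∘ y ∘ w) a <-> f ∘ a = y ∘ w /\ sub_le a m).
  intros W' w a; rewrite <- compA, <- c2P; unfold el, sub_le; simpl; split.
    intros (h & <- & <-); rewrite compA; split; [easy | now exists h].
  intros (fa & h & ->); exists h; now rewrite <- compA.
split.
  intros E12 W' w a fa; now apply (c2E W' w a); rewrite <- E12; apply c1E.
intros H; apply Eext; intros W' w a; rewrite c1E, c2E; firstorder.
Qed.

(** The pullback projections [k'] and [f'] are the generic [a] and [w] of the quantifier, so testing
    them suffices. *)
Lemma forall_along_elements (A B X Y : T) (f : hom A B) (m : hom X A)
    (n : hom Y B) : is_mono n ->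
  (forall (W : T) (y : hom W B), sub_le y n <->
    forall (W' : T) (w : hom W' W) (a : hom W' A),
      f ∘ a = y ∘ w -> sub_le a m) ->
  is_forall_along f m n.
Proof.
intros hn nP; split; [exact hn |]; intros z w k k' f' _ [E U]; rewrite nP; split.
  intros H; exact (H w f' k' E).
intros H W' v a Ea; destruct (U W' a v Ea) as (l & [<- _] & _).
now apply sub_le_restrict.
Qed.

(* The image of [f] is the intersection of all subobjects [S] of [B] such that
   [f] factors through [S]; these [S] form the subobject [U] of the power
   object of [B]. *)
Lemma topos_image (A B : T) (f : hom A B) : exists (I : T) (m : hom I B),
  is_mono m /\ sub_le f m /\
  forall (X : T) (n : hom X B), is_mono n -> sub_le f n -> sub_le m n.
Proof.
destruct (topos_power B) as (PB & E & EM & Eex & _).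
destruct (topos_product PB B) as (Q & q1 & q2 & HQ).
destruct (product_pair HQ (sleft E) (sright E)) as (m0 & m01 & m02).
assert (m0M := pairing_mono m01 m02 EM).
assert (m0E := pairing_sub_le HQ m01 m02).
destruct (topos_product PB A) as (PBA & r1 & r2 & HR).
destruct (product_pair HQ r1 (f ∘ r2)) as (k & k1 & k2).
destruct (topos_pullbacks hT k m0) as (X0 & mk & mk' & mkP).
destruct (topos_forall r1 (pullback_mono m0M mkP)) as (U & i & iM & iP).
assert (iE : forall W (S : hom W PB), sub_le S i <->
    forall W' (w : hom W' W) (a : hom W' A), el E (S ∘ w) (f ∘ a)).
  intros W S; rewrite iP; split.
    intros H W' w a; destruct (product_pair HR (S ∘ w) a) as (y & y1 & y2).
    generalize (H W' w y y1); rewrite (pullback_sub_le mkP), m0E.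
    now rewrite !compA, k1, k2, y1, <- compA, y2.
  intros H W' w y y1; rewrite (pullback_sub_le mkP), m0E.
  rewrite !compA, k1, k2, y1, <- compA; apply H.
destruct (topos_product B U) as (BU & b1 & b2 & HB).
destruct (product_pair HQ (i ∘ b2) b1) as (j & j1 & j2).
destruct (topos_pullbacks hT j m0) as (X1 & mj & mj' & mjP).
destruct (topos_forall b1 (pullback_mono m0M mjP)) as (I & m & mM & mP).
assert (mE : forall W (y : hom W B), sub_le y m <->
    forall W' (w : hom W' W) (x : hom W' BU), b1 ∘ x = y ∘ w ->
      el E (i ∘ (b2 ∘ x)) (y ∘ w)).
  intros W y; rewrite mP; split; intros H W' w x Ex; generalize (H W' w x Ex);
    rewrite (pullback_sub_le mjP), m0E, !compA, j1, j2, Ex; auto.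
exists I, m; split; [exact mM | split].
  apply mE; intros W' w x _.
  assert (ib : sub_le (i ∘ (b2 ∘ x)) i) by now exists (b2 ∘ x).
  rewrite iE in ib; specialize (ib W' (idm _) w); now rewrite compm1 in ib.
(* [n] is one of the subobjects [S]: it enters as the family [c] over [I] constant at [n], tested at
   the generic point [m] of the image. *)
intros X n nM fn; destruct (topos_product I X) as (IX & s1 & s2 & HS).
assert (nE : forall W (z : hom W I) (b : hom W B),
    el (Span s1 (n ∘ s2)) z b <-> sub_le b n).
  intros W z b; unfold el, sub_le; simpl; split.
    intros (h & _ & <-); exists (s2 ∘ h); now rewrite compA.
  intros (h & ->); destruct (product_pair HS z h) as (l & l1 & l2).
  exists l; now rewrite <- compA, l1, l2.
destruct (Eex I (Span s1 (n ∘ s2))) as (c & cP).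
  intros W h l; simpl; rewrite <- !compA; intros E1 E2.
  apply (product_ext HS); auto.
assert (ci : sub_le c i).
  apply iE; intros W' w a; rewrite <- cP, nE; now apply sub_le_restrict.
destruct ci as (c' & ->).
destruct (product_pair HB m c') as (x & x1 & x2).
assert (mm : sub_le m m) by (exists (idm _); now rewrite compm1).
rewrite mE in mm; specialize (mm I (idm _) x).
rewrite !compm1, x2 in mm; specialize (mm x1).
rewrite <- (compm1 (i ∘ c')), <- cP, nE in mm; exact mm.
Qed.

(** If [u ∘ e = v ∘ e], then [f] factors through [m] composed with the equalizer of [u] and [v];
    minimality of the image gives this equalizer a section. *)
Lemma topos_epi_mono (A B : T) (f : hom A B) :
  exists (I : T) (m : hom I B) (e : hom A I),
    is_mono m /\ is_epi e /\ f = m ∘ e.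
Proof.
destruct (topos_image f) as (I & m & mM & (e & fE) & mU).
exists I, m, e; split; [exact mM | split; [| exact fE]].
intros X u v uv; destruct (topos_equalizer u v) as (K & n & nM & nP).
destruct (proj2 (nP A e) uv) as (e' & e'E).
destruct (mU K (m ∘ n)) as (h & hE).
- intros W x y; rewrite <- !compA; intros xy; now apply nM, mM.
- exists e'; now rewrite <- compA, <- e'E.
- assert (nh : n ∘ h = idm I) by (apply mM; now rewrite compm1, compA).
  rewrite <- (compm1 u), <- (compm1 v); apply nP; now exists h.
Qed.

End Topos.

(** * Allegories *)

Section Allegory.

Variables (C : category) (S : allegory_structure C) (hS : is_allegory S).

Local Notation "x ⊑ y" := (ale S x y) (at level 70).
Local Notation "x ⊓ y" := (acap S x y) (at level 50, left associativity).
Local Notation "x °" := (aconv S x) (at level 2, left associativity, format "x °").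
Local Notation is_map := (is_map S).

Implicit Types a b c d : C.

Let refl a b (x : hom a b) : x ⊑ x := ale_refl hS x.
Let trans a b (x y z : hom a b) : x ⊑ y -> y ⊑ z -> x ⊑ z :=
  @ale_trans _ _ hS _ _ x y z.

Lemma cap_lel a b (x y : hom a b) : x ⊓ y ⊑ x.
Proof. now apply (ale_cap hS x y). Qed.

Lemma cap_ler a b (x y : hom a b) : x ⊓ y ⊑ y.
Proof. now apply (ale_cap hS x y). Qed.

Lemma cap_glb a b (x y z : hom a b) : z ⊑ x -> z ⊑ y -> z ⊑ x ⊓ y.
Proof. now intros; apply (ale_cap hS). Qed.

Lemma cap_mono a b (x x' y y' : hom a b) :
  x ⊑ x' -> y ⊑ y' -> x ⊓ y ⊑ x' ⊓ y'.
Proof.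
intros xx yy; apply cap_glb.
  exact (trans (cap_lel x y) xx).
exact (trans (cap_ler x y) yy).
Qed.

Lemma cap_sym a b (x y : hom a b) : x ⊓ y = y ⊓ x.
Proof.
apply (ale_anti hS); apply cap_glb; (apply cap_lel || apply cap_ler).
Qed.

Lemma compl_le a b c (g : hom b c) (f f' : hom a b) :
  f ⊑ f' -> g ∘ f ⊑ g ∘ f'.
Proof. intros; now apply (ale_comp hS). Qed.

Lemma compr_le a b c (g g' : hom b c) (f : hom a b) :
  g ⊑ g' -> g ∘ f ⊑ g' ∘ f.
Proof. intros; now apply (ale_comp hS). Qed.

Lemma compl_le1 a b (e : hom b b) (x : hom a b) : e ⊑ idm b -> e ∘ x ⊑ x.
Proof. intros H; apply (compr_le x) in H; now rewrite comp1m in H. Qed.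

Lemma compr_le1 a b (e : hom a a) (x : hom a b) : e ⊑ idm a -> x ∘ e ⊑ x.
Proof. intros H; apply (compl_le x) in H; now rewrite compm1 in H. Qed.

Lemma compl_ge1 a b (e : hom b b) (x : hom a b) : idm b ⊑ e -> x ⊑ e ∘ x.
Proof. intros H; apply (compr_le x) in H; now rewrite comp1m in H. Qed.

Lemma compr_ge1 a b (e : hom a a) (x : hom a b) : idm a ⊑ e -> x ⊑ x ∘ e.
Proof. intros H; apply (compl_le x) in H; now rewrite compm1 in H. Qed.

Lemma conv_leE a b (x y : hom a b) : x° ⊑ y° <-> x ⊑ y.
Proof.
split; intros H; [| now apply (aconv_le hS)].
rewrite <- (aconvK hS x), <- (aconvK hS y); now apply (aconv_le hS).
Qed.

Lemma conv_le_shift a b (x : hom a b) y : x° ⊑ y <-> x ⊑ y°.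
Proof. now rewrite <- conv_leE, (aconvK hS). Qed.

Lemma conv_cap a b (x y : hom a b) : (x ⊓ y)° = x° ⊓ y°.
Proof.
apply (ale_anti hS).
  apply cap_glb; apply conv_leE; (apply cap_lel || apply cap_ler).
apply conv_le_shift, cap_glb; apply conv_le_shift; (apply cap_lel || apply cap_ler).
Qed.

Lemma modular_left a b c (g : hom b c) (f : hom a b) (h : hom a c) :
  g ∘ f ⊓ h ⊑ g ∘ (f ⊓ g° ∘ h).
Proof.
apply conv_leE; rewrite !conv_cap, !(aconvM hS), !conv_cap, !(aconvM hS), (aconvK hS).
generalize (modular_law hS f° g° h°); now rewrite (aconvK hS).
Qed.

Lemma map_ge1 a b (f : hom a b) : is_map f -> idm a ⊑ f° ∘ f.
Proof. now intros []. Qed.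

Lemma map_le1 a b (f : hom a b) : is_map f -> f ∘ f° ⊑ idm b.
Proof. now intros []. Qed.

(** A map is left adjoint to its converse; [map_shuntr] is the mirror image. *)
Lemma map_shuntl a b c (f : hom b c) (x : hom a b) (y : hom a c) :
  is_map f -> f ∘ x ⊑ y <-> x ⊑ f° ∘ y.
Proof.
intros [f1 f2]; split; intros H.
  apply (trans (y := f° ∘ (f ∘ x))); [| now apply compl_le].
  rewrite compA; now apply compl_ge1.
apply (trans (y := f ∘ (f° ∘ y))); [now apply compl_le |].
rewrite compA; now apply compl_le1.
Qed.

Lemma map_shuntr a b c (f : hom b a) (x : hom b c) (y : hom a c) :
  is_map f -> x ∘ f° ⊑ y <-> x ⊑ y ∘ f.
Proof.
intros fM; rewrite <- conv_leE, <- (conv_leE x), !(aconvM hS), (aconvK hS).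
now apply map_shuntl.
Qed.

(** [g ⊑ g ∘ f° ∘ f ⊑ g ∘ g° ∘ f ⊑ f]. *)
Lemma map_le_eq a b (f g : hom a b) : is_map f -> is_map g -> f ⊑ g -> f = g.
Proof.
intros fM gM fg; apply (ale_anti hS); [exact fg |].
apply (trans (compr_ge1 g (map_ge1 fM))); rewrite compA.
apply compl_le1, (trans (y := g ∘ g°)); [| now apply map_le1].
now apply compl_le, conv_leE.
Qed.

Lemma map_cap_comp a b c (x y : hom b c) (f : hom a b) :
  is_map f -> (x ⊓ y) ∘ f = x ∘ f ⊓ y ∘ f.
Proof.
intros fM; apply (ale_anti hS).
  apply cap_glb; apply compr_le; (apply cap_lel || apply cap_ler).
apply (trans (modular_law hS x f (y ∘ f))), compr_le, cap_mono; [easy |].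
now apply map_shuntr.
Qed.

(** Frobenius reciprocity: one inequality is the modular law, the other the adjunction of [f] and
    [f°]. *)
Lemma map_frobenius_left a b c (f : hom b c) (x : hom a b) (y : hom a c) :
  is_map f -> f ∘ (x ⊓ f° ∘ y) = f ∘ x ⊓ y.
Proof.
intros fM; apply (ale_anti hS); [| apply modular_left].
apply cap_glb; [apply compl_le, cap_lel |].
apply map_shuntl; [easy | apply cap_ler].
Qed.

Lemma map_frobenius_right a b c (f : hom b a) (x : hom b c) (y : hom a c) :
  is_map f -> (x ⊓ y ∘ f) ∘ f° = x ∘ f° ⊓ y.
Proof.
intros fM; apply (ale_anti hS).
  apply cap_glb; [apply compr_le, cap_lel |].
  apply map_shuntr; [easy | apply cap_ler].
generalize (modular_law hS x f° y); now rewrite (aconvK hS).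
Qed.

(** * Tabulations *)

(** The last clause is joint monicity; its converse inequality holds for any two maps. *)
Definition tabulates a b d (f : hom d a) (g : hom d b) (x : hom a b) : Prop :=
  is_map f /\ is_map g /\ g ∘ f° = x /\ f° ∘ f ⊓ g° ∘ g ⊑ idm d.

Lemma tabulates_ext a b d z (f : hom d a) (g : hom d b) (x : hom a b)
    (h k : hom z d) : tabulates f g x -> is_map h -> is_map k ->
  f ∘ h = f ∘ k -> g ∘ h = g ∘ k -> h = k.
Proof.
intros (fM & gM & _ & fg) hM kM fhk ghk; apply map_le_eq; auto.
apply (trans (y := (f° ∘ f ⊓ g° ∘ g) ∘ k)).
  rewrite map_cap_comp by easy; rewrite <- !compA, <- fhk, <- ghk.
  now apply cap_glb; apply map_shuntl.
now apply compl_le1.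
Qed.

(** The factor is [f° ∘ u ⊓ g° ∘ v]: entire because [v ∘ u° ⊑ x], simple by joint monicity. The two
    equations then need only inequalities, by [map_le_eq]. *)
Lemma tabulates_univ a b d z (f : hom d a) (g : hom d b) (x : hom a b)
    (u : hom z a) (v : hom z b) : tabulates f g x -> is_map u -> is_map v ->
  v ∘ u° ⊑ x -> exists h, is_map h /\ f ∘ h = u /\ g ∘ h = v.
Proof.
intros (fM & gM & <- & fg) uM vM uv.
assert (hM : is_map (f° ∘ u ⊓ g° ∘ v)).
  split; rewrite conv_cap, !(aconvM hS), !(aconvK hS).
    set (w := f° ∘ u ⊓ g° ∘ v).
    (* From [idm z ⊑ u° ∘ f ∘ g° ∘ v], the modular law first cuts [g° ∘ v] down to [w], then
       [u° ∘ f] down to [w°]. *)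
    assert (H : idm z ⊑ (u° ∘ f) ∘ w).
      assert (H : idm z ⊑ (u° ∘ f) ∘ (g° ∘ v)).
        apply (trans (y := (u° ∘ u) ∘ (v° ∘ v))).
          rewrite <- (comp1m (idm z)); now apply (ale_comp hS); apply map_ge1.
        apply conv_leE in uv; rewrite !(aconvM hS), !(aconvK hS) in uv.
        rewrite <- !compA; apply compl_le; rewrite !compA; now apply compr_le.
      apply (trans (cap_glb H (refl _))), (trans (modular_left _ _ _)).
      rewrite compm1, (aconvM hS), (aconvK hS), cap_sym; apply refl.
    apply (trans (cap_glb H (refl _))), (trans (modular_law hS _ _ _)).
    rewrite comp1m; apply compr_le.
    apply (trans (cap_ler _ _)); unfold w.
    rewrite conv_cap, !(aconvM hS), !(aconvK hS); apply refl.
  refine (trans _ fg); apply cap_glb.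
    apply (trans (ale_comp hS (cap_lel _ _) (cap_lel _ _))).
    rewrite <- !compA, (compA u); now apply compl_le, compl_le1, map_le1.
  apply (trans (ale_comp hS (cap_ler _ _) (cap_ler _ _))).
  rewrite <- !compA, (compA v); now apply compl_le, compl_le1, map_le1.
exists (f° ∘ u ⊓ g° ∘ v); split; [exact hM |]; split; apply map_le_eq; auto.
- now apply is_map_comp.
- apply map_shuntl; [easy | apply cap_lel].
- now apply is_map_comp.
- apply map_shuntl; [easy | apply cap_ler].
Qed.

(** [f ⊑ f ∘ g° ∘ g], and [f ∘ g°] lies below [(m | m)] because [m] does not distinguish [f] from
    [g]. *)
Lemma sdiv_map_ext (D : division S) a b p (m : hom p a) (f g : hom b p) :
  sdiv D m m = idm p -> is_map f -> is_map g -> m ∘ f = m ∘ g -> f = g.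
Proof.
intros mm fM gM mfg; apply map_le_eq; auto.
apply (trans (compr_ge1 f (map_ge1 gM))); rewrite compA.
apply compl_le1; rewrite <- mm; unfold sdiv; apply cap_glb.
  apply (proj1 (ldivP D hS _ _ _)); rewrite compA, mfg, <- compA.
  now apply compr_le1, map_le1.
apply (proj1 (conv_le_shift _ _)); rewrite (aconvM hS), (aconvK hS).
apply (proj1 (ldivP D hS _ _ _)); rewrite compA, <- mfg, <- compA.
now apply compr_le1, map_le1.
Qed.

End Allegory.

(** * Maps of a unital tabular allegory *)

Section MapTopos.

Variables (C : category) (S : allegory_structure C) (hS : is_allegory S).

Local Notation "x ⊑ y" := (ale S x y) (at level 70).
Local Notation "x ⊓ y" := (acap S x y) (at level 50, left associativity).
Local Notation "x °" := (aconv S x) (at level 2, left associativity, format "x °").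
Local Notation is_map := (is_map S).

Implicit Types a b c d : C.

Let refl a b (x : hom a b) : x ⊑ x := ale_refl hS x.
Let trans a b (x y z : hom a b) : x ⊑ y -> y ⊑ z -> x ⊑ z :=
  @ale_trans _ _ hS _ _ x y z.

(** A unit of the allegory; morphisms to [one] act as predicates on their domain. *)
Variables (one : C) (bang : forall a, hom a one).
Arguments bang : clear implicits.
Hypothesis bang_map : forall a, is_map (bang a).
Hypothesis bang_top : forall a (x : hom a one), x ⊑ bang a.
Hypothesis tabular : forall a b (x : hom a b),
  exists d (f : hom d a) (g : hom d b), tabulates S f g x.

Let M : category := map_category hS.
Let cast a b (f : hom a b) (fM : is_map f) : @hom M a b := MapHom fM.

(** Its tabulations are exactly the products of maps, by [tabulates_product] and
    [product_tabulates]. *)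
Definition top a b : hom a b := (bang b)° ∘ bang a.

Lemma top_max a b (x : hom a b) : x ⊑ top a b.
Proof. apply (map_shuntl hS); [apply bang_map | apply bang_top]. Qed.

Lemma bang_comp a b (f : hom a b) : is_map f -> bang b ∘ f = bang a.
Proof.
intros fM; apply (map_le_eq hS); [apply (is_map_comp hS) | |]; auto.
Qed.

Lemma top_comp a b c (f : hom a b) : is_map f -> top b c ∘ f = top a c.
Proof. intros fM; unfold top; now rewrite <- compA, bang_comp. Qed.

Lemma map_terminal : @is_terminal M one.
Proof.
intros a; exists (cast (bang_map a)); split; [easy |].
intros [f fM] _; apply map_hom_eq; simpl; symmetry.
now apply (map_le_eq hS).
Qed.

(** For maps, [f ∘ u = g ∘ v] amounts to [v ∘ u° ⊑ g° ∘ f], the condition for factoring through a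
    tabulation. *)
Lemma tabulates_pullback a b c d (f : hom a c) (g : hom b c) (p : hom d a)
    (q : hom d b) (fM : is_map f) (gM : is_map g) (pM : is_map p)
    (qM : is_map q) : tabulates S p q (g° ∘ f) ->
  @is_pullback M a b c d (cast fM) (cast gM) (cast pM) (cast qM).
Proof.
intros hpq; split.
  apply map_hom_eq; simpl; symmetry; destruct hpq as (_ & _ & E & _).
  apply (map_le_eq hS); try now apply (is_map_comp hS).
  apply (map_shuntl hS); [easy |]; rewrite compA, <- E.
  rewrite <- compA; now apply (compr_ge1 hS), map_ge1.
intros x [u uM] [v vM] E; apply (f_equal (@map_val _ _ _ _)) in E; simpl in E.
destruct (tabulates_univ hS hpq uM vM) as (h & hM & hu & hv).
  apply (map_shuntr hS); [easy |]; rewrite <- compA.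
  apply (map_shuntl hS); [easy |]; rewrite E; apply refl.
exists (cast hM); split.
  split; now apply map_hom_eq.
intros [k kM] [ku kv].
apply (f_equal (@map_val _ _ _ _)) in ku, kv; simpl in ku, kv.
apply map_hom_eq, (tabulates_ext hS hpq); simpl; congruence.
Qed.

Lemma map_pullbacks : has_pullbacks M.
Proof.
intros a b c [f fM] [g gM]; destruct (tabular (g° ∘ f)) as (d & p & q & hpq).
exists d, (cast (proj1 hpq)), (cast (proj1 (proj2 hpq))).
now apply tabulates_pullback.
Qed.

Lemma tabulates_product a b d (p : hom d a) (q : hom d b) (pM : is_map p)
    (qM : is_map q) : tabulates S p q (top a b) ->
  @is_product M a b d (cast pM) (cast qM).
Proof.
intros hpq x [u uM] [v vM].
destruct (tabulates_univ hS hpq uM vM (top_max _)) as (h & hM & hu & hv).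
exists (cast hM); split.
  split; now apply map_hom_eq.
intros [k kM] [ku kv].
apply (f_equal (@map_val _ _ _ _)) in ku, kv; simpl in ku, kv.
apply map_hom_eq, (tabulates_ext hS hpq); simpl; congruence.
Qed.

(** Used because exponentials are tested on arbitrary products. Some tabulation of [top] factors
    through [p] and [q]; the legs of a tabulation of [p° ∘ p ⊓ q° ∘ q] agree after [p] and after
    [q], hence are equal. *)
Lemma product_tabulates a b d (p : @hom M d a) (q : @hom M d b) :
  is_product p q -> tabulates S (map_val p) (map_val q) (top a b).
Proof.
destruct p as [p pM], q as [q qM]; intros hpq; simpl.
split; [easy | split; [easy | split]].
- destruct (tabular (top a b)) as (c & u & v & (uM & vM & E & _)).
  destruct (product_pair hpq (cast uM) (cast vM)) as ([h hM] & h1 & h2).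
  apply (f_equal (@map_val _ _ _ _)) in h1, h2; simpl in h1, h2.
  apply (ale_anti hS); [apply top_max |].
  rewrite <- E, <- h1, <- h2, (aconvM hS), <- compA, (compA h).
  now apply (compl_le hS), (compl_le1 hS), map_le1.
- destruct (tabular (p° ∘ p ⊓ q° ∘ q)) as (c & u & v & (uM & vM & E & _)).
  assert (uv : cast uM = cast vM).
    assert (H : v ∘ u° ⊑ p° ∘ p ⊓ q° ∘ q) by (rewrite E; apply refl).
    apply (product_ext hpq); apply map_hom_eq; simpl; symmetry;
      (apply (map_le_eq hS); try now apply (is_map_comp hS));
      (apply (map_shuntl hS); [easy |]); rewrite compA;
      (apply (map_shuntr hS); [easy |]); apply (trans H).
      apply cap_lel, hS.
    apply cap_ler, hS.
  apply (f_equal (@map_val _ _ _ _)) in uv; simpl in uv; subst v.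
  rewrite <- E; now apply map_le1.
Qed.

(** The legs of a tabulation of [m° ∘ m] agree after [m]: they are its kernel pair. *)
Lemma mono_simple a b (m : @hom M a b) :
  is_mono m <-> (map_val m)° ∘ map_val m ⊑ idm a.
Proof.
destruct m as [m mM]; simpl; split.
  intros mono; destruct (tabular (m° ∘ m)) as (c & u & v & (uM & vM & E & _)).
  assert (uv : cast uM = cast vM).
    apply mono, map_hom_eq; simpl; symmetry.
    apply (map_le_eq hS); try now apply (is_map_comp hS).
    apply (map_shuntl hS); [easy |]; rewrite compA.
    apply (map_shuntr hS); [easy |]; rewrite E; apply refl.
  apply (f_equal (@map_val _ _ _ _)) in uv; simpl in uv; subst v.
  rewrite <- E; now apply map_le1.
intros mm x [u uM] [v vM] E; apply (f_equal (@map_val _ _ _ _)) in E; simpl in E.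
apply map_hom_eq, (map_le_eq hS); simpl; auto.
apply (trans (y := m° ∘ (m ∘ v))).
  rewrite <- E; apply (map_shuntl hS); auto.
rewrite compA; now apply (compl_le1 hS).
Qed.


(** The candidate factor [m° ∘ u] is simple, so only its entireness is in question. Thus the
    predicate [bang a ∘ m°] encodes the subobject [m]. *)
Lemma factor_mono a b c (m : hom a b) (u : hom c b) :
  is_map m -> m° ∘ m ⊑ idm a -> is_map u ->
  (exists h, is_map h /\ m ∘ h = u) <-> bang a ∘ m° ∘ u = bang c.
Proof.
intros mM mm uM; split.
  intros (h & hM & <-).
  replace (bang a ∘ m° ∘ (m ∘ h)) with (bang a ∘ (m° ∘ m) ∘ h)
    by now rewrite !compA.
  replace (m° ∘ m) with (idm a).
    rewrite compm1; now apply bang_comp.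
  apply (ale_anti hS); [now apply map_ge1 | easy].
intros E; assert (hM : is_map (m° ∘ u)).
  split; rewrite (aconvM hS), (aconvK hS).
    (* A relation [x] with [bang ∘ x = bang] is entire. *)
    assert (H : idm c ⊑ (top c a)° ∘ (m° ∘ u)).
      replace ((top c a)° ∘ (m° ∘ u)) with (top c c).
        apply top_max.
      unfold top; rewrite (aconvM hS), (aconvK hS), <- compA, (compA (bang a)).
      now rewrite E.
    apply (trans (cap_glb hS H (refl _))), (trans (modular_law hS _ _ _)).
    rewrite comp1m; apply (compr_le hS), (trans (cap_ler hS _ _)).
    rewrite (aconvM hS), (aconvK hS); apply refl.
  rewrite <- compA, (compA u); apply (trans (y := m° ∘ m)); [| exact mm].
  now apply (compl_le hS), (compl_le1 hS), map_le1.
exists (m° ∘ u); split; [exact hM |].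
apply (map_le_eq hS); [now apply (is_map_comp hS) | easy |].
now apply (map_shuntl hS).
Qed.

(** Comprehension: the second leg of a tabulation can only be [bang d], so joint monicity reduces to
    monicity of [k]. *)
Lemma tabulate_predicate a (x : hom a one) : exists d (k : hom d a),
  is_map k /\ k° ∘ k ⊑ idm d /\ x = bang d ∘ k°.
Proof.
destruct (tabular x) as (d & k & l & (kM & lM & <- & kl)).
assert (lE : l = bang d) by now apply (map_le_eq hS).
subst l; exists d, k; split; [easy | split; [| easy]].
refine (trans _ kl); apply (cap_glb hS); [apply refl | apply top_max].
Qed.

(** * Subobject classifier of maps *)

Section Power.

Variables (P : C -> C) (mem : forall a, hom (P a) a).
(** With [power_ext], this makes [P] right adjoint to the inclusion of maps into the allegory, with
    counit [mem]. *)
Hypothesis power_ex : forall a b (x : hom b a),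
  exists f, is_map f /\ mem a ∘ f = x.
Hypothesis power_ext : forall a b (f g : hom b (P a)),
  is_map f -> is_map g -> mem a ∘ f = mem a ∘ g -> f = g.

(** Maps to [P one] name predicates: [tr] names the identity of [one], and [m] is classified by the
    name of [bang a ∘ m°]. *)
Lemma map_classifier : exists (o omega : M) (tr : hom o omega),
  is_subobject_classifier tr.
Proof.
destruct (power_ex (idm one)) as (tr & trM & trE).
exists one, (P one), (cast trM); split; [exact map_terminal |].
intros a b [m mM] mono; apply mono_simple in mono; simpl in mono.
destruct (power_ex (bang a ∘ m°)) as (c & cM & cE).
assert (trP : forall d (u : hom d one), mem one ∘ (tr ∘ u) = u).
  intros d u; now rewrite compA, trE, comp1m.
assert (cm : bang a ∘ m° ∘ m = bang a).
  apply (factor_mono mM mono mM); exists (@idm C a); split; [| apply compm1].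
  apply (is_map_id hS).
exists (cast cM); split.
  exists (cast (bang_map a)); split.
    apply map_hom_eq; simpl; apply power_ext; try now apply (is_map_comp hS).
    now rewrite trP, compA, cE.
  intros x [u uM] [v vM] E; apply (f_equal (@map_val _ _ _ _)) in E; simpl in E.
  assert (vE : v = bang x) by now apply (map_le_eq hS).
  subst v; apply (f_equal (comp (mem one))) in E; rewrite trP, compA, cE in E.
  apply (factor_mono mM mono uM) in E; destruct E as (h & hM & hE).
  exists (cast hM); split.
    split; apply map_hom_eq; simpl; [easy | now apply bang_comp].
  intros [k kM] [kE _]; apply (f_equal (@map_val _ _ _ _)) in kE; simpl in kE.
  apply map_hom_eq; simpl; apply (@mono_simple a b (cast mM)) in mono.
  assert (H := mono _ (cast hM) (cast kM)).
  apply (f_equal (@map_val _ _ _ _)) in H; [exact H |].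
  apply map_hom_eq; simpl; congruence.
intros [c' c'M] ([t tM] & [E U]).
apply (f_equal (@map_val _ _ _ _)) in E; simpl in E.
assert (tE : t = bang a) by now apply (map_le_eq hS).
subst t; apply map_hom_eq; simpl; apply power_ext; auto; rewrite cE.
apply (ale_anti hS).
  apply (map_shuntr hS); [easy |].
  rewrite <- compA, E, trP; apply refl.
(* The predicate named by [c'] is comprehended by a mono [k], which factors through the pullback
   [m]; this bounds it by the predicate of [m]. *)
destruct (tabulate_predicate (mem one ∘ c')) as (d & k & kM & kk & kE).
rewrite kE.
destruct (U d (cast kM) (cast (bang_map d))) as ([h hM] & [hE _] & _).
  apply map_hom_eq; simpl; apply power_ext; try now apply (is_map_comp hS).
  rewrite trP, compA, kE; apply (factor_mono kM kk kM).
  exists (@idm C d); split; [apply (is_map_id hS) | apply compm1].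
apply (f_equal (@map_val _ _ _ _)) in hE; simpl in hE.
rewrite <- hE, (aconvM hS), compA; apply (compr_le hS), bang_top.
Qed.

(** * Exponentials *)

(* [za] and [ab] stand for the products [z * a] and [a * b]. *)
Definition uncurry z a b za ab (q1 : hom za z) (q2 : hom za a) (r1 : hom ab a)
    (r2 : hom ab b) (x : hom z ab) : hom za b := r2 ∘ (r1° ∘ q2 ⊓ x ∘ q1).

(** Inverse to [uncurry] on products: in both, [z] is related to [(a, b)] iff [(z, a)] is related to
    [b]. *)
Definition curry z a b za ab (q1 : hom za z) (q2 : hom za a) (r1 : hom ab a)
    (r2 : hom ab b) (y : hom za b) : hom z ab := (r1° ∘ q2 ⊓ r2° ∘ y) ∘ q1°.

(** Precomposition with the map [k] preserves intersections. This reduces uncurrying to the generic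
    relation [mem ab]. *)
Lemma uncurry_natural z z' a b za za' ab (q1 : hom za z) (q2 : hom za a)
    (q1' : hom za' z') (q2' : hom za' a) (r1 : hom ab a) (r2 : hom ab b)
    (h : hom z z') (k : hom za za') (x : hom z' ab) : is_map k ->
  q1' ∘ k = h ∘ q1 -> q2' ∘ k = q2 ->
  uncurry q1 q2 r1 r2 (x ∘ h) = uncurry q1' q2' r1 r2 x ∘ k.
Proof.
intros kM k1 k2; unfold uncurry.
now rewrite <- (compA r2 _ k), (map_cap_comp hS), <- !compA, k1, k2.
Qed.

(** Composing [w] with [q1° ∘ q1] forgets the [a]-component; intersecting with [r1° ∘ q2] restores
    it, as [q1] and [q2] are jointly monic. Frobenius reciprocity does the rest. *)
Lemma curryK z a b za ab (q1 : hom za z) (q2 : hom za a) (r1 : hom ab a)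
    (r2 : hom ab b) (y : hom za b) :
  tabulates S q1 q2 (top z a) -> tabulates S r1 r2 (top a b) ->
  uncurry q1 q2 r1 r2 (curry q1 q2 r1 r2 y) = y.
Proof.
intros (q1M & q2M & _ & qq) (r1M & r2M & rE & _); unfold uncurry, curry.
set (w := r1° ∘ q2 ⊓ r2° ∘ y).
replace (r1° ∘ q2 ⊓ w ∘ q1° ∘ q1) with w.
  unfold w; rewrite (map_frobenius_left hS), compA, rE, top_comp by easy.
  apply (ale_anti hS); [apply (cap_ler hS) |].
  apply (cap_glb hS); [apply top_max | apply refl].
apply (ale_anti hS).
  apply (cap_glb hS); [apply (cap_lel hS) |].
  rewrite <- compA; now apply (compr_ge1 hS), map_ge1.
rewrite (cap_sym hS), <- compA; apply (trans (modular_left hS _ _ _)).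
apply (compr_le1 hS); refine (trans _ qq).
apply (cap_mono hS); [apply refl |]; rewrite compA; apply (compr_le hS).
apply (conv_leE hS); rewrite (aconvM hS), !(aconvK hS).
apply (map_shuntl hS); [easy | apply (cap_lel hS)].
Qed.

Lemma uncurryK z a b za ab (q1 : hom za z) (q2 : hom za a) (r1 : hom ab a)
    (r2 : hom ab b) (x : hom z ab) :
  tabulates S q1 q2 (top z a) -> tabulates S r1 r2 (top a b) ->
  curry q1 q2 r1 r2 (uncurry q1 q2 r1 r2 x) = x.
Proof.
intros (q1M & q2M & qE & _) (r1M & r2M & _ & rr); unfold uncurry, curry.
set (w := r1° ∘ q2 ⊓ x ∘ q1).
replace (r1° ∘ q2 ⊓ r2° ∘ (r2 ∘ w)) with w.
  unfold w; rewrite (map_frobenius_right hS), <- compA, qE by easy.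
  replace (r1° ∘ top z a) with (top z ab).
    apply (ale_anti hS); [apply (cap_ler hS) |].
    apply (cap_glb hS); [apply top_max | apply refl].
  unfold top; now rewrite compA, <- (aconvM hS), bang_comp.
apply (ale_anti hS).
  apply (cap_glb hS); [apply (cap_lel hS) |].
  rewrite compA; now apply (compl_ge1 hS), map_ge1.
rewrite (cap_sym hS), compA; apply (trans (modular_law hS _ _ _)).
apply (compl_le1 hS); refine (trans _ rr); rewrite (cap_sym hS).
apply (cap_mono hS); [| apply refl].
rewrite <- compA; apply (compl_le hS).
apply (conv_leE hS); rewrite (aconvM hS), (aconvK hS).
apply (map_shuntr hS); [easy | apply (cap_lel hS)].
Qed.

(** As [k] is [h * 1], it forms a pullback square over [h]: a tabulation of [h° ∘ q1'] factors
    through [q1] and [k]. *)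
Lemma product_beck_chevalley z z' a za za' (q1 : hom za z) (q2 : hom za a)
    (q1' : hom za' z') (q2' : hom za' a) (h : hom z z') (k : hom za za') :
  tabulates S q1 q2 (top z a) -> tabulates S q1' q2' (top z' a) ->
  is_map h -> is_map k -> q1' ∘ k = h ∘ q1 -> q2' ∘ k = q2 ->
  h° ∘ q1' = q1 ∘ k°.
Proof.
intros hq hq' hM kM k1 k2.
assert (q1M := proj1 hq); assert (q1M' := proj1 hq').
assert (q2M' := proj1 (proj2 hq')).
apply (ale_anti hS).
  destruct (tabular (h° ∘ q1')) as (d & x & y & (xM & yM & E & _)).
  assert (xy : h ∘ y = q1' ∘ x).
    apply (map_le_eq hS); try now apply (is_map_comp hS).
    apply (map_shuntl hS); [easy |]; rewrite compA.
    apply (map_shuntr hS); [easy |]; rewrite E; apply refl.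
  destruct (tabulates_univ (z := d) hS hq yM (is_map_comp hS q2M' xM) (top_max _))
    as (l & lM & l1 & l2).
  assert (lx : k ∘ l = x).
    apply (tabulates_ext hS hq'); try easy; [now apply (is_map_comp hS) | |].
      now rewrite compA, k1, <- compA, l1.
    now rewrite compA, k2.
  rewrite <- E, <- lx, <- l1, (aconvM hS), <- compA, (compA l).
  now apply (compl_le hS), (compl_le1 hS), map_le1.
apply (map_shuntr hS); [easy |]; rewrite <- compA, k1, compA.
now apply (compl_ge1 hS), map_ge1.
Qed.

Variable D : division S.

(* [e] is the subobject of the power object of [A * B] whose points are the
   graphs of maps: [y], classified by [v], is a map iff [v] factors through the
   singleton [sg], and [e] is obtained by quantifying this condition over [A]. *)
Lemma functional_relations a b ab (r1 : hom ab a) (r2 : hom ab b) :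
  exists e (n : hom e (P ab)), is_map n /\ n° ∘ n ⊑ idm e /\
    forall z za (q1 : hom za z) (q2 : hom za a) (w : hom z (P ab)),
      tabulates S q1 q2 (top z a) -> is_map w ->
      (exists h, is_map h /\ n ∘ h = w) <->
      is_map (uncurry q1 q2 r1 r2 (mem ab ∘ w)).
Proof.
destruct (tabular (top (P ab) a)) as (pa & t1 & t2 & ht).
set (y := uncurry t1 t2 r1 r2 (mem ab)).
destruct (power_ex (idm b)) as (sg & sgM & sgE).
assert (sgS : sg° ∘ sg ⊑ idm b).
  apply (@mono_simple b (P b) (cast sgM)); intros c [h hM] [k kM] E.
  apply (f_equal (@map_val _ _ _ _)), (f_equal (comp (mem b))) in E; simpl in E.
  rewrite !compA, sgE, !comp1m in E; now apply map_hom_eq.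
destruct (power_ex y) as (v & vM & vE).
(* Division by [t1] quantifies universally over the [a]-component. *)
destruct (tabulate_predicate (rdiv D t1 (bang b ∘ sg° ∘ v)))
  as (e & n & nM & nS & nE).
exists e, n; split; [easy | split; [easy |]]; intros z za q1 q2 w hq wM.
assert (q1M := proj1 hq); assert (q2M := proj1 (proj2 hq)).
destruct (tabulates_univ (z := za) hS ht (is_map_comp hS wM q1M) q2M (top_max _))
  as (k & kM & k1 & k2).
rewrite (@uncurry_natural z (P ab) a b za pa ab q1 q2 t1 t2 r1 r2 w k (mem ab))
  by easy.
fold y; rewrite (factor_mono nM nS wM), <- nE, <- vE, <- (compA (mem b)).
(* By Beck-Chevalley, the quantified predicate holds along [w] iff the unquantified one holds along
   [k]. *)
transitivity (bang b ∘ sg° ∘ (v ∘ k) = bang za).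
  assert (le_eq : forall c (x : hom c one), x = bang c <-> bang c ⊑ x).
    intros c x; split; [intros ->; apply refl |].
    intros; now apply (ale_anti hS).
  rewrite !le_eq, <- (map_shuntr hS _ _ wM), <- (rdivP D), <- compA.
  rewrite (product_beck_chevalley hq ht wM kM k1 k2), compA.
  now rewrite (map_shuntr hS _ _ kM), (bang_comp q1M), !compA.
rewrite <- (factor_mono sgM sgS (is_map_comp hS vM kM)); split.
  intros (h & hM & <-); now rewrite compA, sgE, comp1m.
intros fM; exists (mem b ∘ (v ∘ k)); split; [easy |].
apply power_ext; try now apply (is_map_comp hS).
now rewrite compA, sgE, comp1m.
Qed.

(** Evaluation uncurries the relation named by [n]. The transpose of [f] names [curry f], and it is
    unique because [n], [mem ab] and [uncurry] can be cancelled in turn. *)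
Lemma map_exponentials (a b : M) :
  exists (e ea : M) (p1 : hom ea e) (p2 : hom ea a) (ev : hom ea b),
    is_exponential p1 p2 ev.
Proof.
destruct (tabular (top a b)) as (ab & r1 & r2 & hr).
destruct (functional_relations r1 r2) as (e & n & nM & nS & nP).
destruct (tabular (top e a)) as (ea & p1 & p2 & hp).
assert (evM : is_map (uncurry p1 p2 r1 r2 (mem ab ∘ n))).
  apply (nP e ea p1 p2 n hp nM); exists (@idm C e); split; [| apply compm1].
  apply (is_map_id hS).
exists e, ea, (cast (proj1 hp)), (cast (proj1 (proj2 hp))), (cast evM).
split; [now apply tabulates_product |].
intros c ca q1 q2 hq [f fM]; assert (hq' := product_tabulates hq).
destruct (power_ex (curry (map_val q1) (map_val q2) r1 r2 f)) as (w & wM & wE).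
assert (hw : exists h, is_map h /\ n ∘ h = w).
  apply (nP c ca (map_val q1) (map_val q2) w hq' wM).
  now rewrite wE, curryK.
destruct hw as (h & hM & hE).
assert (evE : forall (l : @hom M c e) (k : @hom M ca ea),
    cast (proj1 hp) ∘ k = l ∘ q1 -> cast (proj1 (proj2 hp)) ∘ k = q2 ->
    map_val (cast evM ∘ k) =
    uncurry (map_val q1) (map_val q2) r1 r2 (mem ab ∘ (n ∘ map_val l))).
  intros [l lM] [k kM] k1 k2.
  apply (f_equal (@map_val _ _ _ _)) in k1, k2; simpl in k1, k2; simpl.
  now rewrite compA, (@uncurry_natural c e a b ca ea ab _ _ p1 p2 r1 r2 l k).
exists (cast hM); split.
  intros k k1 k2; apply map_hom_eq; rewrite (evE _ _ k1 k2); simpl.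
  now rewrite hE, wE, curryK.
intros [l lM] lP.
destruct (product_pair (tabulates_product (proj1 hp) (proj1 (proj2 hp)) hp)
  (cast lM ∘ q1) q2) as (k & k1 & k2).
assert (E := lP k k1 k2); apply (f_equal (@map_val _ _ _ _)) in E.
rewrite (evE _ _ k1 k2) in E; simpl in E.
apply (@mono_simple e (P ab) (cast nM)); [easy |].
apply map_hom_eq; simpl; apply power_ext; try now apply (is_map_comp hS).
rewrite <- (uncurryK (mem ab ∘ (n ∘ l)) hq' hr), E.
now rewrite hE, wE.
Qed.

Lemma map_topos : is_topos M.
Proof.
split.
- exists one; exact map_terminal.
- exact map_pullbacks.
- exact map_exponentials.
- exact map_classifier.
Qed.

End Power.
End MapTopos.

(** * The allegory of classes of spans *)

Section SpanAllegory.

Variables (T : category) (hT : is_topos T).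
Variables (R : span_relation T) (hR : is_logical R).

Let hC := logical_compatible hR.
Let Q := span_quotient (topos_pullbacks hT) hC.

Variables (S : allegory_structure Q) (hS : is_span_structure S).

Local Notation "x ⊑ y" := (ale S x y) (at level 70).
Local Notation "x ⊓ y" := (acap S x y) (at level 50, left associativity).
Local Notation "x °" := (aconv S x) (at level 2, left associativity, format "x °").

(** [cls] retyped as a morphism of [Q], so that the category and allegory operations apply to it. *)
Definition qcls (A B : T) (s : span A B) : @hom Q A B := cls R s.

Local Notation "⟦ s ⟧" := (qcls s) (format "⟦ s ⟧").

Implicit Types A B D : T.

Lemma qcls_surj A B (x : @hom Q A B) : exists s : span A B, x = ⟦s⟧.
Proof. exact (cls_surj x). Qed.

Lemma qcls_eq A B (s t : span A B) : R s t -> ⟦s⟧ = ⟦t⟧.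
Proof. apply (cls_eq hC). Qed.

Lemma qcls_conv A B (s : span A B) : (⟦s⟧)° = ⟦span_rev s⟧.
Proof. apply (span_convE hS). Qed.

Lemma le_capE A B (x y : @hom Q A B) : x ⊑ y <-> x ⊓ y = x.
Proof. exact (span_leE hS x y). Qed.

Lemma qcls_compE A B D (t : span B D) (s : span A B) w :
  is_span_comp t s w -> ⟦t⟧ ∘ ⟦s⟧ = ⟦w⟧.
Proof. exact (@comp_clsE T (topos_pullbacks hT) R hC A B D t s w). Qed.

(** Trades the pullback for a description by elements; with [qcls_cap] and [qcls_le] it turns
    allegory laws into first-order logic. *)
Lemma qcls_comp A B D (t : span B D) (s : span A B) : exists w,
  ⟦t⟧ ∘ ⟦s⟧ = ⟦w⟧ /\ forall W (x : hom W A) (z : hom W D),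
    el w x z <-> exists y, el s x y /\ el t y z.
Proof.
destruct (span_comp_ex (topos_pullbacks hT) t s) as (w & wP).
exists w; split; [| exact (el_comp wP)].
now apply qcls_compE.
Qed.

Lemma span_cap_ex A B (s t : span A B) : exists w, is_span_cap s t w.
Proof.
destruct (topos_product hT A B) as (AB & p1 & p2 & HP).
destruct (product_pair HP (sleft s) (sright s)) as (u & hu).
destruct (product_pair HP (sleft t) (sright t)) as (v & hv).
destruct (topos_pullbacks hT u v) as (z & p & q & pq).
exists (Span (sleft s ∘ p) (sright s ∘ p)), AB, p1, p2, u, v, z, p, q; auto.
Qed.

Lemma qcls_cap A B (s t : span A B) : exists w,
  ⟦s⟧ ⊓ ⟦t⟧ = ⟦w⟧ /\ forall W (x : hom W A) (y : hom W B),
    el w x y <-> el s x y /\ el t x y.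
Proof.
destruct (span_cap_ex s t) as (w & wP); exists w; split; [| exact (el_cap wP)].
now apply (span_capE hS).
Qed.

Lemma qcls_cap_sym A B (s t : span A B) : ⟦s⟧ ⊓ ⟦t⟧ = ⟦t⟧ ⊓ ⟦s⟧.
Proof.
destruct (span_cap_ex s t) as (w & wP); transitivity ⟦w⟧.
  now apply (span_capE hS).
symmetry; apply (span_capE hS).
destruct wP as (AB & p1 & p2 & u & v & z & p & q & HP & [u1 u2] & [v1 v2] & pq & ->).
exists AB, p1, p2, v, u, z, q, p; do 3 (split; [now idtac |]).
split; [now apply pullback_sym |].
rewrite <- u1, <- u2, <- v1, <- v2, <- !compA; now rewrite (proj1 pq).
Qed.

(** [(f e, g e)] is [(e, e)] composed with [(f, 1)] before and [(1, g)] after, so condition (i)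
    applies. *)
Lemma qcls_epi A B D E (f : hom D A) (g : hom D B) (e : hom E D) : is_epi e ->
  ⟦Span (f ∘ e) (g ∘ e)⟧ = ⟦Span f g⟧.
Proof.
intros he.
assert (H : forall k : span D D, ⟦Span (idm D) g⟧ ∘ (⟦k⟧ ∘ ⟦Span f (idm D)⟧) =
    ⟦Span (f ∘ sleft k) (g ∘ sright k)⟧).
  intros [K k l]; cbn [sleft sright].
  rewrite (@qcls_compE A D D (Span k l) (Span f (idm D)) (Span (f ∘ k) l)).
    apply qcls_compE; exists K, (idm K), l; simpl; split; [| now rewrite compm1].
    split; [now rewrite comp1m, compm1 |].
    intros W u v; rewrite comp1m; intros <-; exists u; split.
      split; [apply comp1m | easy].
    intros h [<- _]; now rewrite comp1m.
  exists K, k, (idm K); simpl; split; [| now rewrite compm1].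
  split; [now rewrite comp1m, compm1 |].
  intros W u v; rewrite comp1m; intros ->; exists v; split.
    split; [easy | apply comp1m].
  intros h [_ <-]; now rewrite comp1m.
assert (H1 := H (Span e e)); rewrite (qcls_eq (logical_epi hR he)), H in H1.
cbn [sleft sright span_id] in H1; now rewrite !compm1 in H1.
Qed.

(** When the legs of [s] are an element of [t], the projection defining the intersection has a
    section, hence is epi. *)
Lemma qcls_le A B (s t : span A B) :
  (forall W (x : hom W A) (y : hom W B), el s x y -> el t x y) -> ⟦s⟧ ⊑ ⟦t⟧.
Proof.
intros st; apply le_capE; destruct (span_cap_ex s t) as (w & wP).
transitivity ⟦w⟧; [now apply (span_capE hS) |].
destruct wP as (AB & p1 & p2 & u & v & z & p & q & HP & [u1 u2] & [v1 v2] & pq & ->).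
transitivity ⟦Span (sleft s) (sright s)⟧; [| now destruct s].
destruct (st _ _ _ (el_legs s)) as (h & h1 & h2).
destruct (proj2 pq _ (idm _) h) as (l & [l1 _] & _).
  apply (product_ext HP); rewrite compm1, ?compA; congruence.
apply qcls_epi; intros W a b ab.
now rewrite <- (compm1 a), <- (compm1 b), <- l1, !compA, ab.
Qed.

(** A weak converse of [qcls_le]: the elements of [s] need not lie in [t], but [s] shrinks to a
    representative of its class that does. *)
Lemma qcls_le_ex A B (s t : span A B) : ⟦s⟧ ⊑ ⟦t⟧ -> exists w,
  ⟦w⟧ = ⟦s⟧ /\ (jointly_monic s -> jointly_monic t -> jointly_monic w) /\
  forall W (x : hom W A) (y : hom W B),
    el w x y <-> el s x y /\ el t x y.
Proof.
intros st; destruct (span_cap_ex s t) as (w & wP).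
exists w; split; [| split; [| exact (el_cap wP)]].
  apply le_capE in st; rewrite <- st; symmetry; now apply (span_capE hS).
intros sM tM.
destruct wP as (AB & p1 & p2 & u & v & z & p & q & HP & _ & [v1 v2] & pq & ->).
assert (pM := pullback_mono (pairing_mono v1 v2 tM) pq).
intros W h k; simpl; rewrite <- !compA; intros E1 E2; now apply pM, sM.
Qed.

Let anti A B (x y : @hom Q A B) : x ⊑ y -> y ⊑ x -> x = y.
Proof.
destruct (qcls_surj x) as [s ->], (qcls_surj y) as [t ->]; intros xy yx.
apply le_capE in xy, yx; rewrite <- xy, qcls_cap_sym; exact yx.
Qed.

Lemma qcls_ext A B (s t : span A B) :
  (forall W (x : hom W A) (y : hom W B), el s x y <-> el t x y) -> ⟦s⟧ = ⟦t⟧.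
Proof. intros st; apply anti; apply qcls_le; intros W x y; apply st. Qed.

Let capA A B (x y z : @hom Q A B) : x ⊓ (y ⊓ z) = x ⊓ y ⊓ z.
Proof.
destruct (qcls_surj x) as [s ->], (qcls_surj y) as [t ->], (qcls_surj z) as [u ->].
destruct (qcls_cap t u) as (v & -> & vP), (qcls_cap s v) as (w & -> & wP).
destruct (qcls_cap s t) as (v' & -> & vP'), (qcls_cap v' u) as (w' & -> & wP').
apply qcls_ext; intros W a b; rewrite wP, vP, wP', vP'; tauto.
Qed.

(** Laws are checked on elements of representatives; for monotonicity of composition and converse,
    these are first shrunk by [qcls_le_ex]. *)
Lemma span_allegory : is_allegory S.
Proof.
assert (trans : forall A B (x y z : @hom Q A B), x ⊑ y -> y ⊑ z -> x ⊑ z).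
  intros A B x y z xy yz; apply le_capE in xy, yz; apply le_capE.
  transitivity (x ⊓ y ⊓ z); [now rewrite xy | now rewrite <- capA, yz].
split.
- intros A B x; destruct (qcls_surj x) as [s ->]; now apply qcls_le.
- exact trans.
- exact anti.
- intros A B D y y' x x'.
  destruct (qcls_surj x) as [s ->], (qcls_surj x') as [s' ->].
  destruct (qcls_surj y) as [t ->], (qcls_surj y') as [t' ->]; intros yy xx.
  destruct (qcls_le_ex yy) as (v & <- & _ & vP), (qcls_le_ex xx) as (u & <- & _ & uP).
  destruct (qcls_comp v u) as (w & -> & wP), (qcls_comp t' s') as (w' & -> & wP').
  apply qcls_le; intros W a b; rewrite wP, wP'; intros (c & Hu & Hv); exists c.
  now split; [apply uP | apply vP].
- intros A B x y z; split.
    intros H; split; apply (trans _ _ _ _ _ H);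
      destruct (qcls_surj x) as [s ->], (qcls_surj y) as [t ->];
      destruct (qcls_cap s t) as (w & -> & wP);
      apply qcls_le; intros W a b; apply wP.
  intros [zx zy]; apply le_capE in zx, zy; apply le_capE.
  now rewrite capA, zx.
- intros A B x; destruct (qcls_surj x) as [[D f g] ->]; now rewrite !qcls_conv.
- intros A; exact (@qcls_conv A A (@span_id T A)).
- intros A B D y x; destruct (qcls_surj x) as [s ->], (qcls_surj y) as [t ->].
  rewrite !qcls_conv; destruct (qcls_comp t s) as (w & -> & wP).
  destruct (qcls_comp (span_rev s) (span_rev t)) as (w' & -> & wP').
  rewrite qcls_conv; apply qcls_ext; intros W a b; rewrite el_rev, wP, wP'.
  split; intros (c & H1 & H2); exists c; revert H1 H2; rewrite !el_rev; auto.
- intros A B x y; destruct (qcls_surj x) as [s ->], (qcls_surj y) as [t ->].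
  intros xy; destruct (qcls_le_ex xy) as (w & <- & _ & wP); rewrite !qcls_conv.
  apply qcls_le; intros W a b; rewrite !el_rev; apply wP.
- intros A B D y x z.
  destruct (qcls_surj x) as [s ->], (qcls_surj y) as [t ->], (qcls_surj z) as [u ->].
  rewrite qcls_conv; destruct (qcls_comp t s) as (c & -> & cP).
  destruct (qcls_cap c u) as (d & -> & dP).
  destruct (qcls_comp u (span_rev s)) as (c' & -> & cP').
  destruct (qcls_cap t c') as (d' & -> & dP').
  destruct (qcls_comp d' s) as (e & -> & eP).
  apply qcls_le; intros W a b; rewrite dP, cP, eP.
  intros [(b' & H1 & H2) H3]; exists b'; split; [easy |].
  rewrite dP', cP'; split; [easy |]; exists a; now rewrite el_rev.
Qed.

(** * Graphs, images and tabulations *)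

Let hA := span_allegory.

Lemma graph_map A B (f : hom A B) : is_map S ⟦graph f⟧.
Proof.
split; rewrite qcls_conv.
  destruct (qcls_comp (span_rev (graph f)) (graph f)) as (w & -> & wP).
  apply (@qcls_le A A (span_id A)); intros W x y; rewrite el_id, wP; intros <-.
  exists (f ∘ x); now rewrite el_rev, el_graph.
destruct (qcls_comp (graph f) (span_rev (graph f))) as (w & -> & wP).
apply (@qcls_le B B w (span_id B)); intros W x y; rewrite el_id, wP.
intros (z & H1 & H2); revert H1 H2; rewrite el_rev, !el_graph; congruence.
Qed.

(** Precomposition with a graph is substitution, a pullback of [t], so relations stay jointly
    monic. *)
Lemma qcls_comp_graph A B D (t : span B D) (f : hom A B) : exists w,
  ⟦t⟧ ∘ ⟦graph f⟧ = ⟦w⟧ /\ (jointly_monic t -> jointly_monic w) /\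
  forall W (x : hom W A) (z : hom W D), el w x z <-> el t (f ∘ x) z.
Proof.
destruct (topos_pullbacks hT f (sleft t)) as (p & p1 & p2 & pP).
set (w := Span (idm A ∘ p1) (sright t ∘ p2)).
assert (hw : is_span_comp t (graph f) w) by now exists p, p1, p2.
exists w; split; [now apply qcls_compE | split].
  intros tM W h k; simpl; rewrite !comp1m, <- !compA; intros E1 E2.
  apply (pullback_ext pP); [easy | apply tM; [| easy]].
  now rewrite !compA, <- (proj1 pP), <- !compA, E1.
intros W x z; rewrite (el_comp hw); split.
  intros (y & H1 & H2); revert H1 H2; rewrite el_graph; now intros ->.
intros H; exists (f ∘ x); now rewrite el_graph.
Qed.

(** Reduces division by a span to its two legs. *)
Lemma qcls_legs A B (s : span A B) :
  ⟦s⟧ = ⟦graph (sright s)⟧ ∘ (⟦graph (sleft s)⟧)°.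
Proof.
rewrite qcls_conv.
destruct (qcls_comp (graph (sright s)) (span_rev (graph (sleft s)))) as (w & -> & wP).
apply qcls_ext; intros W x y; rewrite wP; split.
  intros (h & <- & <-); exists h; now rewrite el_rev, !el_graph.
intros (h & H1 & H2); revert H1 H2; rewrite el_rev, !el_graph; intros.
now exists h.
Qed.

(** Condition (i) absorbs the epi part, so every class contains a relation. *)
Lemma qcls_image A B (s : span A B) : exists m : span A B,
  jointly_monic m /\ ⟦m⟧ = ⟦s⟧ /\
  forall W (x : hom W A) (y : hom W B), el s x y -> el m x y.
Proof.
destruct s as [D f g]; destruct (topos_product hT A B) as (AB & p1 & p2 & HP).
destruct (product_pair HP f g) as (u & <- & <-).
destruct (topos_epi_mono hT u) as (I & m & e & mM & eE & ->).
exists (Span (p1 ∘ m) (p2 ∘ m)); split; [| split].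
- intros W h k; simpl; rewrite <- !compA; intros E1 E2.
  now apply mM, (product_ext HP).
- rewrite !compA; symmetry; now apply qcls_epi.
- intros W x y (h & <- & <-); exists (e ∘ h); simpl; now rewrite !compA.
Qed.

Lemma qcls_surj_mono A B (x : @hom Q A B) :
  exists s, jointly_monic s /\ x = ⟦s⟧.
Proof.
destruct (qcls_surj x) as [t ->], (qcls_image t) as (s & sM & <- & _); now exists s.
Qed.

Lemma qcls_tabular A B (x : @hom Q A B) :
  exists (D : Q) (f : hom D A) (g : hom D B), tabulates S f g x.
Proof.
destruct (qcls_surj_mono x) as (s & sM & ->).
exists (apex s), ⟦graph (sleft s)⟧, ⟦graph (sright s)⟧.
split; [apply graph_map | split; [apply graph_map | split]].
  symmetry; apply qcls_legs.
rewrite !qcls_conv.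
destruct (qcls_comp_graph (span_rev (graph (sleft s))) (sleft s)) as (c & -> & _ & cP).
destruct (qcls_comp_graph (span_rev (graph (sright s))) (sright s)) as (d & -> & _ & dP).
destruct (qcls_cap c d) as (w & -> & wP).
apply (@qcls_le _ _ w (span_id (apex s))); intros W x y.
rewrite wP, cP, dP, el_id, !el_rev, !el_graph; intros [H1 H2]; now apply sM.
Qed.

(** * Division *)

(* Elementwise form of [q] being the universal quantification of [t] along
   [g * 1]. *)
Definition is_span_forall A B D (g : hom A B) (t : span A D) (q : span B D) :=
  forall W (y : hom W B) (z : hom W D), el q y z <->
    forall W' (w : hom W' W) (x : hom W' A), g ∘ x = y ∘ w -> el t x (z ∘ w).

(** Passes from pairs of elements to elements of products, where condition (ii) is phrased. *)
Lemma is_span_forallE A B D (g : hom A B) (t : span A D) (q : span B D)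
    AD BD (p1 : hom AD A) (p2 : hom AD D) (r1 : hom BD B) (r2 : hom BD D)
    (g1 : hom AD BD) (m : hom (apex t) AD) (n : hom (apex q) BD) :
  is_product p1 p2 -> is_product r1 r2 ->
  r1 ∘ g1 = g ∘ p1 -> r2 ∘ g1 = p2 ->
  p1 ∘ m = sleft t -> p2 ∘ m = sright t ->
  r1 ∘ n = sleft q -> r2 ∘ n = sright q ->
  is_span_forall g t q <-> forall W (y : hom W BD), sub_le y n <->
    forall W' (w : hom W' W) (x : hom W' AD), g1 ∘ x = y ∘ w -> sub_le x m.
Proof.
intros HP HR gr1 gr2 m1 m2 n1 n2.
assert (mE := pairing_sub_le HP m1 m2); assert (nE := pairing_sub_le HR n1 n2).
assert (H : forall W (y : hom W BD),
    (forall W' (w : hom W' W) (x : hom W' AD), g1 ∘ x = y ∘ w -> sub_le x m) <->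
    (forall W' (w : hom W' W) (x : hom W' A),
      g ∘ x = r1 ∘ y ∘ w -> el t x (r2 ∘ y ∘ w))).
  intros W y; split; intros H W' w x xw.
    destruct (product_pair HP x (r2 ∘ y ∘ w)) as (l & l1 & l2).
    rewrite <- l1, <- l2; apply mE, (H W' w), (product_ext HR); rewrite !compA.
      now rewrite gr1, <- compA, l1.
    now rewrite gr2.
  apply mE; rewrite <- gr2, <- (compA r2), xw, compA; apply H.
  now rewrite compA, <- gr1, <- (compA r1), xw, compA.
split.
  intros K W y; rewrite nE, H; apply K.
intros K W y z; destruct (product_pair HR y z) as (l & <- & <-).
now rewrite <- nE, K, H.
Qed.

Lemma span_forall_ex A B D (g : hom A B) (t : span A D) : jointly_monic t ->
  exists q, jointly_monic q /\ is_span_forall g t q.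
Proof.
intros tM; destruct (topos_product hT A D) as (AD & p1 & p2 & HP).
destruct (topos_product hT B D) as (BD & r1 & r2 & HR).
destruct (product_pair HP (sleft t) (sright t)) as (m & m1 & m2).
destruct (product_pair HR (g ∘ p1) p2) as (g1 & gr1 & gr2).
destruct (topos_forall hT g1 (pairing_mono m1 m2 tM)) as (Y & n & nM & nP).
exists (Span (r1 ∘ n) (r2 ∘ n)); split.
  intros W h k; simpl; rewrite <- !compA; intros E1 E2.
  now apply nM, (product_ext HR).
now apply (@is_span_forallE A B D g t (Span (r1 ∘ n) (r2 ∘ n)) AD BD p1 p2
  r1 r2 g1 m n).
Qed.

(** This is where condition (ii) enters; a jointly monic span has a monic pairing, which is its own
    mono part. *)
Lemma span_forall_qcls A B D (g : hom A B) (t t' : span A D) (q q' : span B D) :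
  jointly_monic t -> jointly_monic t' -> jointly_monic q -> jointly_monic q' ->
  is_span_forall g t q -> is_span_forall g t' q' -> ⟦t⟧ = ⟦t'⟧ -> ⟦q⟧ = ⟦q'⟧.
Proof.
intros tM tM' qM qM' tq tq' E; apply (cls_eq hC) in E.
destruct (topos_product hT A D) as (AD & p1 & p2 & HP).
destruct (topos_product hT B D) as (BD & r1 & r2 & HR).
destruct (product_pair HR (g ∘ p1) p2) as (g1 & gr1 & gr2).
destruct (product_pair HP (sleft t) (sright t)) as (m & m1 & m2).
destruct (product_pair HP (sleft t') (sright t')) as (m' & m1' & m2').
destruct (product_pair HR (sleft q) (sright q)) as (n & n1 & n2).
destruct (product_pair HR (sleft q') (sright q')) as (n' & n1' & n2').
assert (nM := pairing_mono n1 n2 qM); assert (nM' := pairing_mono n1' n2' qM').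
assert (part : forall X (k : hom X AD), is_mono k -> is_mono_part k k).
  intros X k kM; split; [exact kM | exists (idm X); split; [| now rewrite compm1]].
  intros W u v; now rewrite !compm1.
assert (nP := proj1 (is_span_forallE HP HR gr1 gr2 m1 m2 n1 n2) tq).
assert (nP' := proj1 (is_span_forallE HP HR gr1 gr2 m1' m2' n1' n2') tq').
apply qcls_eq; clear tq tq'.
destruct q as [d f h], q' as [d' f' h']; simpl in *.
rewrite <- n1, <- n2, <- n1', <- n2'.
apply (logical_forall hR E HP HR m1 m2 m1' m2' gr1 gr2
  (part _ _ (pairing_mono m1 m2 tM)) (part _ _ (pairing_mono m1' m2' tM')));
  now apply forall_along_elements.
Qed.

(** The hypothesis compares classes, not elements. Let [m] be the image of [u] after the graph of
    [g], and [w] its part inside [t], of the same class. Their quantifications [q'] and [q''] give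
    [u ⊑ q' = q'' ⊑ q], with the equality from condition (ii). *)
Lemma span_forall_adjoint A B D (g : hom A B) (t : span A D) (q : span B D) :
  jointly_monic t -> jointly_monic q -> is_span_forall g t q ->
  forall x : @hom Q B D, x ∘ ⟦graph g⟧ ⊑ ⟦t⟧ <-> x ⊑ ⟦q⟧.
Proof.
intros tM qM tq x; destruct (qcls_surj x) as [u ->]; split.
  destruct (qcls_comp_graph u g) as (c & -> & _ & cP).
  destruct (qcls_image c) as (m & mM & <- & mP); intros mt.
  destruct (qcls_le_ex mt) as (w & wE & wM & wP).
  destruct (span_forall_ex g mM) as (q' & qM' & mq').
  destruct (span_forall_ex g (wM mM tM)) as (q'' & qM'' & wq'').
  apply (ale_trans hA (g := ⟦q'⟧)).
    apply qcls_le; intros W y z yz; apply mq'; intros W' v a av.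
    apply mP, cP; rewrite av; now apply el_restrict.
  rewrite <- (span_forall_qcls (wM mM tM) mM qM'' qM' wq'' mq' wE).
  apply qcls_le; intros W y z yz; apply tq; intros W' v a av.
  apply wP; exact (proj1 (wq'' W y z) yz W' v a av).
intros uq; apply (ale_trans hA (g := ⟦q⟧ ∘ ⟦graph g⟧)).
  now apply (compr_le hA).
destruct (qcls_comp_graph q g) as (c & -> & _ & cP).
apply qcls_le; intros W y z yz; apply cP in yz.
rewrite <- (compm1 z); apply (proj1 (tq _ _ _) yz); now rewrite compm1.
Qed.

(** With [f] and [g] the legs of [s], [x ∘ g ∘ f° ⊑ t] iff [x ∘ g ⊑ t ∘ f], and the latter is
    adjoint to quantification along [g]. *)
Lemma qcls_division A B D (s : span A B) (t : span A D) : jointly_monic t ->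
  exists q : span B D,
    (forall x : @hom Q B D, x ∘ ⟦s⟧ ⊑ ⟦t⟧ <-> x ⊑ ⟦q⟧) /\
    (forall W (y : hom W B) (z : hom W D), el q y z <->
      forall W' (w : hom W' W) (d : hom W' (apex s)),
        sright s ∘ d = y ∘ w -> el t (sleft s ∘ d) (z ∘ w)).
Proof.
intros tM; destruct (qcls_comp_graph t (sleft s)) as (c & cE & cM & cP).
destruct (span_forall_ex (sright s) (cM tM)) as (q & qM & cq).
exists q; split.
  intros x; rewrite qcls_legs, compA, (map_shuntr hA) by apply graph_map.
  rewrite cE; now apply span_forall_adjoint; [apply cM | |].
intros W y z; rewrite (cq W y z); split; intros H W' w d E;
  specialize (H W' w d E); now apply cP.
Qed.

Lemma span_division : inhabited (division S).
Proof.
assert (H : forall (A B D : Q) (x : hom A B) (y : hom A D),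
    exists r : hom B D, forall h, h ∘ x ⊑ y <-> h ⊑ r).
  intros A B D x y; destruct (qcls_surj x) as [s ->].
  destruct (qcls_surj_mono y) as (t & tM & ->).
  destruct (qcls_division s tM) as (q & qP & _); now exists ⟦q⟧.
pose (r (A B D : Q) (x : hom A B) (y : hom A D) :=
  constructive_indefinite_description _ (H A B D x y)).
constructor; apply (@Division Q S (fun A B D x y => proj1_sig (r A B D x y))).
intros A B D x y; exact (proj2_sig (r A B D x y)).
Qed.

(** * Power objects *)

Section Membership.

Variables (A PA : T) (E : span PA A).
Hypothesis EM : jointly_monic E.
Hypothesis E_ex : forall (Z : T) (r : span Z A), jointly_monic r ->
  exists c : hom Z PA, forall (W : T) (z : hom W Z) (a : hom W A),
    el r z a <-> el E (c ∘ z) a.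
Hypothesis E_ext : forall (Z : T) (c c' : hom Z PA),
  (forall (W : T) (z : hom W Z) (a : hom W A),
    el E (c ∘ z) a <-> el E (c' ∘ z) a) -> c = c'.

Lemma qcls_power_ex (B : T) (x : @hom Q B A) :
  exists f : @hom Q B PA, is_map S f /\ ⟦E⟧ ∘ f = x.
Proof.
destruct (qcls_surj_mono x) as (r & rM & ->), (E_ex rM) as (c & cP).
exists ⟦graph c⟧; split; [apply graph_map |].
destruct (qcls_comp_graph E c) as (w & -> & _ & wP).
apply qcls_ext; intros W z a; now rewrite wP, cP.
Qed.

(** By uniqueness of adjoints the quotient is [q], which is inclusion of named subobjects; mutual
    inclusion is equality by [E_ext]. *)
Lemma qcls_power_sdiv (D : division S) : sdiv D ⟦E⟧ ⟦E⟧ = @idm Q PA.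
Proof.
assert (revM : jointly_monic (span_rev E)) by (intros W h k H1 H2; now apply EM).
destruct (qcls_division (span_rev E) revM) as (q & qP & qE).
assert (rE : rdiv D (⟦E⟧)° (⟦E⟧)° = ⟦q⟧).
  rewrite qcls_conv; apply anti.
    apply qP, (rdivP D), (ale_refl hA).
  apply (rdivP D), qP, (ale_refl hA).
unfold sdiv, ldiv; rewrite rE, (aconvK hA), qcls_conv.
destruct (qcls_cap (span_rev q) q) as (w & wE & wP).
transitivity ⟦w⟧; [exact wE |].
apply (@qcls_ext PA PA w (span_id PA)); intros W x y.
rewrite wP, el_rev, el_id, !qE; simpl; split.
  intros [H1 H2]; apply E_ext; intros V z a; split; intros (d & d1 & <-).
    rewrite <- el_rev; now apply H2.
  rewrite <- el_rev; now apply H1.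
intros <-; split; intros V z d <-; rewrite el_rev; now exists d.
Qed.

End Membership.

(** * The power allegory and its topos of maps *)

Lemma span_power (D : division S) :
  exists (P : Q -> Q) (mem : forall A : Q, hom (P A) A),
    (forall A : Q, sdiv D (mem A) (mem A) = idm (P A)) /\
    (forall (A B : Q) (x : hom B A),
      exists f, is_map S f /\ mem A ∘ f = x).
Proof.
pose (P := fun A : T => constructive_indefinite_description _ (topos_power hT A)).
pose (E := fun A : T => constructive_indefinite_description _ (proj2_sig (P A))).
exists (fun A => proj1_sig (P A)), (fun A => ⟦proj1_sig (E A)⟧).
split; intros A; destruct (proj2_sig (E A)) as (EM & Eex & Eext).
  exact (qcls_power_sdiv EM Eext D).
intros B x; exact (qcls_power_ex Eex x).
Qed.

(** If the map [c] names [x], then [c°] and [c] lie below the two factors, and the identity lies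
    below [c° ∘ c]. *)
Lemma span_power_allegory : is_power_allegory S.
Proof.
destruct span_division as [D], (span_power D) as (P & mem & mm & mem_ex).
split; [split; [exact hA | now constructor] |].
exists D, P, mem; split; [exact mm |]; intros A B x.
destruct (mem_ex A B x) as (c & cM & cE).
apply (ale_trans hA (map_ge1 cM)), (ale_comp hA).
  apply (proj1 (ldivP D hA _ _ _)), (map_shuntr hA); [exact cM |].
  rewrite cE; apply (ale_refl hA).
apply (proj1 (ldivP D hA _ _ _)); rewrite cE; apply (ale_refl hA).
Qed.

(** The terminal object of the topos is a unit: any element of a span into it belongs to the graph
    of the unique morphism. *)
Lemma span_map_topos (hP : is_power_allegory S) : is_topos (map_category hP).
Proof.
destruct (topos_terminal hT) as [one h1].
assert (bang : forall A, exists f : @hom Q A one, is_map S f /\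
    forall x : @hom Q A one, x ⊑ f).
  intros A; destruct (h1 A) as (f & _).
  exists ⟦graph f⟧; split; [apply graph_map |]; intros x.
  destruct (qcls_surj x) as [s ->]; apply qcls_le; intros W a b _.
  apply el_graph; destruct (h1 W) as (k & _ & kU).
  transitivity k; [symmetry |]; now apply kU.
pose (b := fun A => constructive_indefinite_description _ (bang A)).
destruct span_division as [D], (span_power D) as (P & mem & mm & mem_ex).
apply (@map_topos Q S hP one (fun A => proj1_sig (b A))
  (fun A => proj1 (proj2_sig (b A))) (fun A => proj2 (proj2_sig (b A)))
  qcls_tabular P mem mem_ex); [| exact D].
intros A B f g; exact (sdiv_map_ext hA (mm A)).
Qed.

End SpanAllegory.

Theorem theorem5p9 (T : category) (hT : is_topos T)
    (R : span_relation T) (hR : is_logical R)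
    (S : allegory_structure
           (span_quotient (topos_pullbacks hT) (logical_compatible hR)))
    (hS : is_span_structure S) :
  exists hP : is_power_allegory S, is_topos (map_category hP).
Proof. exists (span_power_allegory hS); apply span_map_topos, hS. Qed.
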